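(* Let $\mathfrak{C}\subseteq\mathbb{R}^{1\times\ell}\langle x,x^*\rangle$ be a finite right chip space, and let $I\subseteq\mathbb{R}^{1\times\ell}\langle x,x^*\rangle$ be a left module generated by polynomials in $\mathbb{R}\langle x,x^*\rangle_1\mathfrak{C}$. Let $(\{\iota_i\}_{i=1}^\mu,\{\vartheta_j\}_{j=1}^\sigma)$ be a $\mathfrak{C}$-basis for $I$. Then $I$ is real if and only if whenever $$\sum_i^{\text{finite}}p_i^*p_i=\sum_{j=1}^\mu(q_j^*\iota_j+\iota_j^*q_j)+\sum_{k=1}^\sigma(\alpha_k^*\vartheta_k+\vartheta_k^*\alpha_k)$$ for some $p_i,q_j\in\mathfrak{C}$ and $\alpha_k\in\mathbb{R}^{1\times\ell}\cap\mathfrak{C}$, then each $p_i\in I$.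
   Context: $\langle x,x^*\rangle$ is the free monoid on letters $x_1,\ldots,x_g,x_1^*,\ldots,x_g^*$ (empty word $=1$, $|w|$ is length), $\mathbb{R}\langle x,x^*\rangle$ the free $\mathbb{R}$-algebra it spans, with linear involution exchanging $x_i,x_i^*$ and satisfying $(pq)^*=q^*p^*$. $\mathbb{R}^{\nu\times\ell}\langle x,x^*\rangle=\mathbb{R}^{\nu\times\ell}\otimes\mathbb{R}\langle x,x^*\rangle$ with involution $(\sum_wA_w\otimes w)^*=\sum_wA_w^*\otimes w^*$ ($A^*$ the transpose). Monomials of $\mathbb{R}^{1\times\ell}\langle x,x^*\rangle$ are $e_j\otimes w$, $e_j$ standard row vectors, $w$ a word. $\mathbb{R}\langle x,x^*\rangle_1$ is the space of polynomials of degree at most $1$. $\mathbb{R}^{1\times\ell}\cap\mathfrak{C}$ is the set of constant elements of $\mathfrak{C}$. For sets, $AB$ is the linear span of products $ab$, $A^*=\{a^*\mid a\in A\}$, and $A\setminus B$ is set difference. ''Left module'' means a left $\mathbb{R}\langle x,x^*\rangle$-submodule of $\mathbb{R}^{1\times\ell}\langle x,x^*\rangle$. A left module $I$ is real if whenever a finite sum $\sum_ip_i^*p_i$, $p_i\in\mathbb{R}^{1\times\ell}\langle x,x^*\rangle$, lies in $\mathbb{R}^{\ell\times1}I+I^*\mathbb{R}^{1\times\ell}$, each $p_i\in I$. A monomial $m_2$ is a right chip of a monomial $m_1$ if $m_1=wm_2$ for some word $w$. A right chip space is a linear space spanned by monomials that contains, with every monomial in it, all right chips of that monomial; it is finite if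 finite dimensional. A degree order $\prec_0$ is a total order on $\langle x,x^*\rangle$ with $a\prec_0b$ whenever $|a|<|b|$. A $\mathfrak{C}$-order induced by $\prec_0$ is a total order $\prec_{\mathfrak{C}}$ on the monomials of $\mathbb{R}^{1\times\ell}\langle x,x^*\rangle$ such that $a\prec_{\mathfrak{C}}b$ whenever one of the following holds: (1) $a\in\mathfrak{C}$, $b\notin\mathfrak{C}$; (2) $a\in\mathbb{R}\langle x,x^*\rangle\mathfrak{C}$, $b\notin\mathbb{R}\langle x,x^*\rangle\mathfrak{C}$; (3) $a=a_1a_2$, $b=b_1b_2$ with monomials $a_2,b_2\in\mathbb{R}\langle x,x^*\rangle_1\mathfrak{C}\setminus\mathfrak{C}$, words $a_1\prec_0b_1$; (4) $a=wa_2$, $b=wb_2$ with $w$ a word, monomials $a_2,b_2\in\mathbb{R}\langle x,x^*\rangle_1\mathfrak{C}\setminus\mathfrak{C}$ and $a_2\prec_{\mathfrak{C}}b_2$. The leading monomial of a polynomial is its largest monomial; a polynomial is monic if its leading monomial has coefficient $1$. Fix a $\mathfrak{C}$-order. For a left module $I$ generated by polynomials in $\mathbb{R}\langle x,x^*\rangle_1\mathfrak{C}$, a $\mathfrak{C}$-basis for $I$ is a pair $(\{\iota_i\}_i,\{\vartheta_j\}_j)$ where $\{\iota_i\}$ is a maximal set of monic polynomials in $I\cap(\mathbb{R}\langle x,x^*\rangle_1\mathfrak{C}\setminus\mathfrak{C})$ with distinct leading monomials and $\{\vartheta_j\}$ is a maximal (possibly empty) set of monic polynomials in $I\cap\mathfrak{C}$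 with distinct leading monomials. *)

(* Defs.v *)
From mathcomp Require Import all_boot all_algebra.
From mathcomp Require Import finmap.
From mathcomp Require Import classical_sets reals.
From mathcomp.multinomials Require Import monalg.

Set Implicit Arguments.
Unset Strict Implicit.
Unset Printing Implicit Defensive.

Import GRing.Theory.

Local Open Scope classical_set_scope.
Local Open Scope ring_scope.

(* [(i, false)] stands for x_i and [(i, true)] for x_i^*. *)
Definition letter (g : nat) := ('I_g * bool)%type.
Definition word (g : nat) := {fmonom (letter g)}.

Definition word_star (g : nat) (w : word g) : word g :=
  FMonom (rev [seq (a.1, ~~ a.2) | a <- w]).

Definition ncpoly (R : realType) (g : nat) := {malg R[word g]}.

Definition ncpoly_star (R : realType) (g : nat) (p : ncpoly R g) :
    ncpoly R g :=
  \sum_(w <- msupp p) << p@_w *g word_star w >>.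

(* Polynomials with m x n matrix coefficients are identified with m x n
   matrices of polynomials; the involution is the starred transpose. *)
Definition ncmx (R : realType) (g m n : nat) := 'M[ncpoly R g]_(m, n).
Definition ncrow (R : realType) (g l : nat) := ncmx R g 1 l.

Definition mxstar (R : realType) (g m n : nat) (M : ncmx R g m n) :
    ncmx R g n m :=
  map_mx (@ncpoly_star R g) M^T.

Definition const_ncmx (R : realType) (g m n : nat) : set (ncmx R g m n) :=
  range (map_mx (@malgC (word g) R) : 'M[R]_(m, n) -> ncmx R g m n).

Definition linear_subspace (R : realType) (g m n : nat)
    (V : set (ncmx R g m n)) : Prop :=
  V 0 /\ forall (c : R) u v, V u -> V v -> V ((c%:MP : ncpoly R g) *: u + v).

Definition linspan (R : realType) (g m n : nat) (S : set (ncmx R g m n)) :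
    set (ncmx R g m n) :=
  smallest (@linear_subspace R g m n) S.

Definition finite_dimensional (R : realType) (g m n : nat)
    (V : set (ncmx R g m n)) : Prop :=
  exists s : seq (ncmx R g m n), V = linspan [set` s].

Definition scale_span (R : realType) (g l : nat)
    (A : set (ncpoly R g)) (B : set (ncrow R g l)) : set (ncrow R g l) :=
  linspan [set a *: b | a in A & b in B].

Definition mul_span (R : realType) (g m n p : nat)
    (A : set (ncmx R g m n)) (B : set (ncmx R g n p)) : set (ncmx R g m p) :=
  linspan [set a *m b | a in A & b in B].

Definition deg_le1 (R : realType) (g : nat) : set (ncpoly R g) :=
  [set a | forall w, w \in msupp a -> (fdeg w <= 1)%N].

Definition left_module (R : realType) (g l : nat) (I : set (ncrow R g l)) :
    Prop :=
  I 0 /\ forall (a : ncpoly R g) u v, I u -> I v -> I (a *: u + v).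

Definition left_module_gen (R : realType) (g l : nat)
    (S : set (ncrow R g l)) : set (ncrow R g l) :=
  smallest (@left_module R g l) S.

Definition real_module (R : realType) (g l : nat) (I : set (ncrow R g l)) :
    Prop :=
  forall ps : seq (ncrow R g l),
    [set u + v | u in mul_span (@const_ncmx R g l 1) I
               & v in mul_span (@mxstar R g 1 l @` I) (@const_ncmx R g 1 l)]
      (\sum_(p <- ps) mxstar p *m p) ->
    forall p, p \in ps -> I p.

(* [(j, w)] stands for the monomial e_j (x) w. *)
Definition monomial (g l : nat) := ('I_l * word g)%type.

Definition monomial_poly (R : realType) (g l : nat) (m : monomial g l) :
    ncrow R g l :=
  (<< m.2 >> : ncpoly R g) *: delta_mx 0 m.1.

Definition wmul (g l : nat) (w : word g) (m : monomial g l) : monomial g l :=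
  (m.1, mmul w m.2).

Definition row_coeff (R : realType) (g l : nat) (p : ncrow R g l)
    (m : monomial g l) : R :=
  (p 0 m.1)@_m.2.

Definition right_chip (g l : nat) (m2 m1 : monomial g l) : Prop :=
  exists w : word g, m1 = wmul w m2.

Definition right_chip_space (R : realType) (g l : nat)
    (C : set (ncrow R g l)) : Prop :=
  (exists M : set (monomial g l), C = linspan (@monomial_poly R g l @` M)) /\
  (forall m1 m2 : monomial g l, C (monomial_poly R m1) -> right_chip m2 m1 ->
     C (monomial_poly R m2)).

Definition strict_total_order (T : eqType) (lt : rel T) : Prop :=
  [/\ irreflexive lt, transitive lt & forall a b, a != b -> lt a b || lt b a].

Definition degree_order (g : nat) (lt0 : rel (word g)) : Prop :=
  strict_total_order lt0 /\
  forall a b : word g, (fdeg a < fdeg b)%N -> lt0 a b.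

Definition border (R : realType) (g l : nat) (C : set (ncrow R g l)) :
    set (ncrow R g l) :=
  scale_span (@deg_le1 R g) C `\` C.

Definition C_order (R : realType) (g l : nat) (C : set (ncrow R g l))
    (lt0 : rel (word g)) (ltC : rel (monomial g l)) : Prop :=
  let E := @monomial_poly R g l in
  strict_total_order ltC /\
  [/\ forall a b, C (E a) -> ~ C (E b) -> ltC a b,
      forall a b, scale_span setT C (E a) -> ~ scale_span setT C (E b) ->
        ltC a b,
      forall (a1 b1 : word g) (a2 b2 : monomial g l),
        border C (E a2) -> border C (E b2) -> lt0 a1 b1 ->
        ltC (wmul a1 a2) (wmul b1 b2)
    & forall (w : word g) (a2 b2 : monomial g l),
        border C (E a2) -> border C (E b2) -> ltC a2 b2 ->
        ltC (wmul w a2) (wmul w b2)].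

Definition leading (R : realType) (g l : nat) (lt : rel (monomial g l))
    (p : ncrow R g l) (m : monomial g l) : Prop :=
  row_coeff p m != 0 /\
  forall m', row_coeff p m' != 0 -> m' != m -> lt m' m.

Definition monic (R : realType) (g l : nat) (lt : rel (monomial g l))
    (p : ncrow R g l) : Prop :=
  exists2 m, leading lt p m & row_coeff p m = 1.

Definition distinct_monic (R : realType) (g l : nat)
    (lt : rel (monomial g l)) (X S : set (ncrow R g l)) : Prop :=
  [/\ S `<=` X,
      forall p, S p -> monic lt p
    & forall p q m, S p -> S q -> leading lt p m -> leading lt q m -> p = q].

Definition maximal_distinct_monic (R : realType) (g l : nat)
    (lt : rel (monomial g l)) (X S : set (ncrow R g l)) : Prop :=
  distinct_monic lt X S /\
  forall S', distinct_monic lt X S' -> S `<=` S' -> S' = S.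

Definition C_basis (R : realType) (g l : nat) (lt : rel (monomial g l))
    (C I iotas thetas : set (ncrow R g l)) : Prop :=
  maximal_distinct_monic lt (I `&` border C) iotas /\
  maximal_distinct_monic lt (I `&` C) thetas.

(* Main.v *)
(* Let the b_k be the minimal monomials outside C, and let beta_j be the vector
   of coefficients of iota_j at the b_k. Distinct leading monomials make the
   beta_j linearly independent, and I = sum R<x,x*> iota_j + sum R theta_k.
   Subtracting elements of I, every polynomial can be brought to a normal form
   whose coefficient vectors at the monomials w b_k are orthogonal to all beta_j.
   Put the p_i in normal form, and write the multipliers of the iota_j as n_j
   plus a combination of the iota_i, with n_j in normal form. Then
     sum p_i^* p_i = sum (n_j^* iota_j + iota_j^* n_j)
                     + sum iota_i^* s_ij iota_j + theta terms.
   At words b_k^* w b_k' with w of the largest degree that occurs, the left side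
   gives a Gram matrix annihilated by the beta_j, while on the right the terms
   u (x) beta_j, beta_j (x) u and beta_i (x) beta_j with u orthogonal to the beta
   are independent. So the top parts of the p_i, n_j and s_ij vanish; descending
   on the degree, p_i and n_j lie in C and s_ij = 0, which is the identity of
   the hypothesis. Of the order on monomials only rule (1) is used. *)
Require Import Defs.
From HB Require Import structures.
From mathcomp Require Import all_boot all_order all_algebra.
From mathcomp Require Import finmap.
From mathcomp Require Import boolp classical_sets reals.
From mathcomp.multinomials Require Import monalg.

Set Implicit Arguments.
Unset Strict Implicit.
Unset Printing Implicit Defensive.

Import GRing.Theory Num.Theory Order.TTheory.

Local Open Scope classical_set_scope.
Local Open Scope ring_scope.

(** * Words and the involution *)

Section Words.
Context (g : nat).
Implicit Types (s t : seq (letter g)) (u v w : word g).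

Definition letter_star (a : letter g) : letter g := (a.1, ~~ a.2).
Definition seq_star s : seq (letter g) := rev (map letter_star s).

Lemma letter_starK : involutive letter_star.
Proof. by case=> i b; rewrite /letter_star /= negbK. Qed.

Lemma word_starE w : word_star w = FMonom (seq_star w).
Proof. by []. Qed.

Lemma size_seq_star s : size (seq_star s) = size s.
Proof. by rewrite size_rev size_map. Qed.

Lemma seq_starK : involutive seq_star.
Proof. by move=> s; rewrite /seq_star map_rev revK mapK //; apply: letter_starK. Qed.

Lemma seq_star_cat s t : seq_star (s ++ t) = seq_star t ++ seq_star s.
Proof. by rewrite /seq_star map_cat rev_cat. Qed.

Lemma word_starK : involutive (@word_star g).
Proof. by move=> w; rewrite !word_starE /= seq_starK fmK. Qed.

Lemma fdeg_star w : fdeg (word_star w) = fdeg w.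
Proof. by rewrite !fdegE word_starE size_seq_star. Qed.

Lemma mmulE u v : mmul u v = FMonom (u ++ v).
Proof. by rewrite -[LHS]fmK fmM. Qed.

End Words.

(** * Coefficients of products and stars in the free algebra *)

Section Polynomials.
Context (R : realType) (g : nat).
Implicit Types (p q : ncpoly R g) (u v w : word g).

Lemma coeff_starE p w : (ncpoly_star p)@_w = p@_(word_star w).
Proof.
rewrite /ncpoly_star raddf_sum /=.
under eq_bigr => u _ do rewrite mcoeffU (can2_eq (@word_starK g) (@word_starK g)).
have [wp|wp] := boolP (word_star w \in msupp p).
  rewrite (bigD1_seq (word_star w)) ?fset_uniq //= eqxx big1 ?addr0 //.
  by move=> u /negbTE ->.
rewrite (mcoeff_outdom wp) big_seq big1 // => u up.
by case: eqP => // E; rewrite -E up in wp.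
Qed.

Lemma ncpoly_star_is_additive : additive (@ncpoly_star R g).
Proof.
move=> p q; apply/malgP => w; apply: etrans (coeff_starE _ _) _.
rewrite mcoeffB; apply: esym; apply: etrans (mcoeffB _ _ _) _.
by congr (_ - _); apply: coeff_starE.
Qed.

HB.instance Definition _ :=
  GRing.isAdditive.Build (ncpoly R g) (ncpoly R g) (@ncpoly_star R g)
    ncpoly_star_is_additive.

Lemma ncpoly_starK : involutive (@ncpoly_star R g).
Proof. by move=> p; apply/malgP => w; rewrite !coeff_starE word_starK. Qed.

(** In the free monoid the factorisations of a word are its cuts into a prefix and a suffix, so
    convolution becomes a sum over cut positions. *)
Lemma coeffM p q w : (p * q)@_w =
  \sum_(i < (size w).+1) p@_(FMonom (take i w)) * q@_(FMonom (drop i w)).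
Proof.
rewrite {1}(monalgE p) {1}(monalgE q) mulr_suml raddf_sum /=.
under eq_bigr => u _ do rewrite mulr_sumr raddf_sum /=.
(* Expanding the coefficients on the right into monomials as well makes both sides double sums over
   [u] and [v], compared term by term. *)
transitivity (\sum_(i < (size w).+1)
   (\sum_(u <- msupp p) << p@_u *g u >>)@_(FMonom (take i w)) *
   (\sum_(v <- msupp q) << q@_v *g v >>)@_(FMonom (drop i w)));
  last by rewrite -!monalgE.
under [RHS]eq_bigr => i _ do
  rewrite !raddf_sum /= mulr_suml (eq_bigr _ (fun u _ => mulr_sumr _ _ _ _)).
rewrite [RHS]exchange_big /=; apply: eq_bigr => u _.
rewrite [RHS]exchange_big /=; apply: eq_bigr => v _.
rewrite malgM_def fgmulUU mcoeffU.
under eq_bigr => i _ do rewrite !mcoeffU.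
have [<-|neq] := eqVneq (mmul u v) w.
  rewrite mmulE /=.
  have lt : (size u < (size (u ++ v)).+1)%N by rewrite size_cat ltnS leq_addr.
  rewrite (bigD1 (Ordinal lt)) //= take_size_cat // drop_size_cat // !fmK.
  rewrite !eqxx big1 ?addr0 // => i ni.
  case: eqP => [E|]; last by rewrite mul0r.
  case/eqP: ni; apply: val_inj => /=.
  by rewrite {2}E /= size_takel // -ltnS.
rewrite big1 // => i _; case: eqP => [E|]; last by rewrite mul0r.
case: eqP => [F|]; last by rewrite mulr0.
by case/eqP: neq; rewrite mmulE E F /= cat_take_drop fmK.
Qed.

Lemma ncpoly_starM p q : ncpoly_star (p * q) = ncpoly_star q * ncpoly_star p.
Proof.
apply/malgP => w; rewrite coeff_starE !coeffM word_starE /= size_seq_star.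
(* Reversing the word sends the cut at [i] to the cut at [size w - i]. *)
rewrite (reindex_inj rev_ord_inj) /=; apply: eq_bigr => i _.
rewrite subSS !coeff_starE !word_starE /= mulrC.
have E : seq_star w = seq_star (drop i w) ++ seq_star (take i w).
  by rewrite -seq_star_cat cat_take_drop.
have S : size (seq_star (drop i w)) = (size w - i)%N.
  by rewrite size_seq_star size_drop.
by rewrite E drop_size_cat ?take_size_cat.
Qed.

Lemma ncpoly_starC (c : R) : ncpoly_star (c%:MP) = c%:MP :> ncpoly R g.
Proof.
apply/malgP => w; rewrite coeff_starE !mcoeffC; congr (_ *+ nat_of_bool _).
by rewrite -!fdeg_eq0 fdeg_star.
Qed.

End Polynomials.

(** * The involution on matrices of polynomials *)

Section Matrices.
Context (R : realType) (g : nat).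

Lemma mxstar_is_additive m n : additive (@mxstar R g m n).
Proof. by move=> A B; apply/matrixP => i j; rewrite !mxE raddfB. Qed.

HB.instance Definition _ m n :=
  GRing.isAdditive.Build (ncmx R g m n) (ncmx R g n m) (@mxstar R g m n)
    (@mxstar_is_additive m n).

Lemma mxstar0 m n : mxstar (0 : ncmx R g m n) = 0.
Proof. exact: raddf0. Qed.

Lemma mxstarD m n (A B : ncmx R g m n) : mxstar (A + B) = mxstar A + mxstar B.
Proof. exact: raddfD. Qed.

Lemma mxstar_sum m n (T : Type) (s : seq T) (F : T -> ncmx R g m n) :
  mxstar (\sum_(i <- s) F i) = \sum_(i <- s) mxstar (F i).
Proof. exact: raddf_sum. Qed.

Lemma mxstarK m n : cancel (@mxstar R g m n) (@mxstar R g n m).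
Proof. by move=> A; apply/matrixP => i j; rewrite !mxE ncpoly_starK. Qed.

Lemma mxstarM m n p (A : ncmx R g m n) (B : ncmx R g n p) :
  mxstar (A *m B) = mxstar B *m mxstar A.
Proof.
apply/matrixP => i j; rewrite !mxE raddf_sum /=; apply: eq_bigr => k _.
by rewrite !mxE ncpoly_starM.
Qed.

Lemma mxstarZ n (a : ncpoly R g) (A : ncrow R g n) :
  mxstar (a *: A) = mxstar A *m (ncpoly_star a)%:M.
Proof.
by apply/matrixP => i j; rewrite !mxE big_ord1 !mxE ord1 eqxx ncpoly_starM.
Qed.

End Matrices.

(** * Coefficients of rows, and of products at the words [b_k1^* s b_k2] *)

Section Coefficients.
Context (R : realType) (g l : nat).
Implicit Types (P Q : ncrow R g l) (m : monomial g l) (a : ncpoly R g).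

Lemma row_coeff0 m : row_coeff (0 : ncrow R g l) m = 0.
Proof. by rewrite /row_coeff mxE mcoeff0. Qed.

Lemma row_coeffD m P Q : row_coeff (P + Q) m = row_coeff P m + row_coeff Q m.
Proof. by rewrite /row_coeff mxE mcoeffD. Qed.

Lemma row_coeffB m P Q : row_coeff (P - Q) m = row_coeff P m - row_coeff Q m.
Proof. by rewrite /row_coeff !mxE mcoeffB. Qed.

Lemma row_coeff_sum m (T : Type) (r : seq T) (F : T -> ncrow R g l) :
  row_coeff (\sum_(i <- r) F i) m = \sum_(i <- r) row_coeff (F i) m.
Proof. by rewrite /row_coeff summxE raddf_sum. Qed.

Lemma row_coeffC c P m :
  row_coeff ((c%:MP : ncpoly R g) *: P) m = c * row_coeff P m.
Proof. by rewrite /row_coeff mxE mcoeffCM. Qed.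

Lemma row_coeffZ a P j (u : word g) : row_coeff (a *: P) (j, u) =
  \sum_(i < (size u).+1) a@_(FMonom (take i u)) * row_coeff P (j, FMonom (drop i u)).
Proof. by rewrite /row_coeff mxE coeffM. Qed.

Lemma row_coeffP P Q : (forall m, row_coeff P m = row_coeff Q m) -> P = Q.
Proof.
move=> E; apply/rowP => j; apply/malgP => w.
by have := E (j, w); rewrite /row_coeff.
Qed.

Lemma row_coeff_monomial m m' :
  row_coeff (monomial_poly R m) m' = (m == m')%:R.
Proof.
case: m m' => [i u] [j w]; rewrite /row_coeff /monomial_poly !mxE /= eq_sym.
have [->|neq] := eqVneq i j; rewrite /= ?mulr1 ?mulr0 ?mcoeff0 xpair_eqE.
  by rewrite eqxx mcoeffU1.
by rewrite (negbTE neq).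
Qed.

Lemma row_monomialE P : exists2 s : seq (monomial g l),
  forall m, m \in s = (row_coeff P m != 0) &
  P = \sum_(m <- s) ((row_coeff P m)%:MP : ncpoly R g) *: monomial_poly R m.
Proof.
pose s := [seq (j, w) | j <- enum 'I_l, w <- msupp (P 0 j)].
have us : uniq s.
  apply: allpairs_uniq_dep => [|j _|]; rewrite ?enum_uniq ?fset_uniq //.
  by move=> [i u] [j w] _ _ /= [-> ->].
have ms m : m \in s = (row_coeff P m != 0).
  case: m => j w; rewrite /row_coeff mcoeff_neq0 /=.
  apply/allpairsPdep/idP => [[i [u [_ ? [-> ->]]]] //|wP].
  by exists j, w; rewrite mem_enum.
exists s => //; apply: row_coeffP => m; rewrite row_coeff_sum.
under eq_bigr => m' _ do rewrite row_coeffC row_coeff_monomial.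
have [ims|nims] := boolP (m \in s).
  rewrite (bigD1_seq m) //= eqxx mulr1 big1 ?addr0 // => m' /negbTE ->.
  by rewrite mulr0.
rewrite big_seq big1 => [|m' m's]; first by move: nims; rewrite ms negbK => /eqP.
case: eqP => [E|_]; last by rewrite mulr0.
by rewrite -E m's in nims.
Qed.

Lemma coeff_mxstar_mul P Q i j (w : word g) : ((mxstar P *m Q) i j)@_w =
  \sum_(k < (size w).+1) row_coeff P (i, FMonom (seq_star (take k w))) *
                         row_coeff Q (j, FMonom (drop k w)).
Proof.
rewrite mxE big_ord1 coeffM; apply: eq_bigr => k _.
by rewrite !mxE coeff_starE word_starE.
Qed.

(* With [b] enumerating the minimal monomials outside a chip space, [bdeg b 0]
   describes the elements of that space, and [bdeg b d] those elements of the
   form [\sum_k a_k *: b k + c] with [c] in the space and each [a_k] of degree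
   less than [d]. *)
Definition bdeg r (b : 'I_r -> monomial g l) d P :=
  forall k (s : seq (letter g)), (d <= size s)%N ->
    row_coeff P ((b k).1, FMonom (s ++ (b k).2)) = 0.

Section Products.
Context (r : nat) (b : 'I_r -> monomial g l).
Implicit Types (s : seq (letter g)) (k : 'I_r).

(** For fixed [s], letting [k1] and [k2] vary gives a real [r] by [r] matrix; the descent compares
    the two sides of the identity through these matrices. *)
Definition midc (Q : ncmx R g l l) k1 k2 s : R :=
  (Q (b k1).1 (b k2).1)@_(FMonom (seq_star (b k1).2 ++ s ++ (b k2).2)).

Lemma midcD (Q Q' : ncmx R g l l) k1 k2 s :
  midc (Q + Q') k1 k2 s = midc Q k1 k2 s + midc Q' k1 k2 s.
Proof. by rewrite /midc mxE mcoeffD. Qed.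

Lemma midc_sum (I : Type) (t : seq I) (F : I -> ncmx R g l l) k1 k2 s :
  midc (\sum_(i <- t) F i) k1 k2 s = \sum_(i <- t) midc (F i) k1 k2 s.
Proof. by rewrite /midc summxE raddf_sum. Qed.

(* A split of [b_k1^* s b_k2] outside the block [s] leaves [t b_k] on one side
   with [t] longer than [s], where the degree bounds force a zero coefficient. *)
Lemma mid_term d d' P Q k1 k2 s n (w := seq_star (b k1).2 ++ s ++ (b k2).2) :
  bdeg b d P -> bdeg b d' Q ->
  (d <= (size s).+1)%N -> (d' <= (size s).+1)%N ->
  (n <= size w)%N ->
  (forall i, (i <= size s)%N -> n = (size (b k1).2 + i)%N -> (i < d)%N ->
     (size s - i < d')%N -> False) ->
  row_coeff P ((b k1).1, FMonom (seq_star (take n w))) *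
  row_coeff Q ((b k2).1, FMonom (drop n w)) = 0.
Proof.
move=> dP dQ ds d's nw H; rewrite {}/w in nw *.
have S1 : size (seq_star (b k1).2) = size (b k1).2 by rewrite size_seq_star.
have [n1|n1] := ltnP n (size (b k1).2).
  have -> : drop n (seq_star (b k1).2 ++ s ++ (b k2).2) =
            (drop n (seq_star (b k1).2) ++ s) ++ (b k2).2.
    by rewrite drop_cat S1 n1 catA.
  rewrite dQ ?mulr0 // size_cat size_drop S1.
  by apply: leq_trans d's _; rewrite -add1n leq_add2r subn_gt0.
rewrite take_cat drop_cat S1 ltnNge n1 /=.
set i := (n - size (b k1).2)%N; have ni : n = (size (b k1).2 + i)%N by rewrite subnKC.
have [si|si] := ltnP (size s) i.
  rewrite take_cat ltnNge (ltnW si) /= !seq_star_cat seq_starK.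
  rewrite dP ?mul0r // size_cat !size_seq_star.
  apply: leq_trans ds _; rewrite size_takel; last first.
    by rewrite leq_subLR -(leq_add2l (size (b k1).2)) -ni -S1 -!size_cat.
  by rewrite -[X in (X < _)%N]add0n ltn_add2r subn_gt0.
(* The cut now falls inside [s], after [i] letters; it can contribute only if [i < d] and
   [size s - i < d'], which [H] excludes. *)
have [di|di] := leqP d i.
  rewrite takel_cat // seq_star_cat seq_starK dP ?mul0r //.
  by rewrite size_seq_star size_takel.
have [d'i|d'i] := leqP d' (size s - i).
  rewrite -{2}(cat_take_drop i s) -catA drop_size_cat ?size_takel //.
  by rewrite dQ ?mulr0 // size_drop.
by case: (H i).
Qed.

(** A contributing cut of [s] has at most [d - 1] letters on its left and [d' - 1] on its right, too
    few to make up [s]. *)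
Lemma mid0 d d' P Q k1 k2 s : bdeg b d P -> bdeg b d' Q ->
  (d <= (size s).+1)%N -> (d' <= (size s).+1)%N -> (d + d' <= (size s).+1)%N ->
  midc (mxstar P *m Q) k1 k2 s = 0.
Proof.
move=> dP dQ ds d's dd; rewrite /midc coeff_mxstar_mul big1 // => n _.
apply: mid_term dP dQ ds d's _ _ => [|i si _ di]; first by rewrite -ltnS.
apply/negP; rewrite -leqNgt leq_subRL // -ltnS; apply: leq_trans dd.
by rewrite -addSn leq_add2r.
Qed.

(** At this length exactly one cut contributes, the one after the first [d] letters of [s], and it
    multiplies the two top-degree parts. *)
Lemma midE d d' P Q k1 k2 s : bdeg b d.+1 P -> bdeg b d'.+1 Q ->
  size s = (d + d')%N ->
  midc (mxstar P *m Q) k1 k2 s =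
  row_coeff P ((b k1).1, FMonom (seq_star (take d s) ++ (b k1).2)) *
  row_coeff Q ((b k2).1, FMonom (drop d s ++ (b k2).2)).
Proof.
move=> dP dQ ss; rewrite /midc coeff_mxstar_mul /=.
have ds : (d <= size s)%N by rewrite ss leq_addr.
set w := seq_star (b k1).2 ++ _.
have lt : (size (b k1).2 + d < (size w).+1)%N.
  by rewrite ltnS /w !size_cat size_seq_star leq_add2l (leq_trans ds) ?leq_addr.
rewrite (bigD1 (Ordinal lt)) //= big1 ?addr0 => [|n nd].
  rewrite /w take_cat drop_cat size_seq_star ltnNge leq_addr /= addKn.
  rewrite takel_cat // seq_star_cat seq_starK drop_cat.
  congr (_ * row_coeff _ (_, FMonom _)).
  case: ltnP => // sd; have -> : d = size s by apply/eqP; rewrite eqn_leq ds.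
  by rewrite subnn drop0 drop_size.
apply: mid_term dP dQ _ _ _ _; rewrite ?ltnS ?ss ?leq_addr ?leq_addl //.
  by rewrite -ltnS.
move=> i si ni; rewrite !ltnS leq_subLR leq_add2r => id id'.
by case/eqP: nd; apply/val_inj/eqP; rewrite /= ni eqn_add2l eqn_leq id id'.
Qed.

(** Only the cut at the end of [s] contributes: an earlier one leaves [t b_k] with [t] nonempty,
    where [P] vanishes, and a later one has a prefix longer than [D], where [a] vanishes. *)
Lemma row_coeffZ_top a P D k s :
  (forall u : word g, (D < fdeg u)%N -> a@_u = 0) -> bdeg b 1 P ->
  (D <= size s)%N ->
  row_coeff (a *: P) ((b k).1, FMonom (s ++ (b k).2)) =
  a@_(FMonom s) * row_coeff P (b k).
Proof.
move=> aD dP Ds; rewrite row_coeffZ /=.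
have lt : (size s < (size (s ++ (b k).2)).+1)%N by rewrite ltnS size_cat leq_addr.
rewrite (bigD1 (Ordinal lt)) //= take_size_cat // drop_size_cat // fmK.
rewrite -surjective_pairing big1 ?addr0 // => i ni.
have [ltis|ltsi|E] := ltngtP i (size s).
- by rewrite drop_cat ltis dP ?mulr0 // size_drop subn_gt0.
- rewrite aD ?mul0r // fdegE size_takel; last by rewrite -ltnS.
  exact: leq_ltn_trans ltsi.
- by case/eqP: ni; apply: val_inj.
Qed.

End Products.
End Coefficients.

(** * Descent on the degree *)

Section GramMatrices.
Context (R : realType) (n r : nat) (beta : 'M[R]_(n, r)).
Hypothesis beta_free : row_free beta.

(** If [v] kills the Gram matrix, the squared norm of [v *m beta] is zero; over the reals this gives
    [v *m beta = 0], and freeness gives [v = 0]. *)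
Lemma gram_unit : beta *m beta^T \in unitmx.
Proof.
rewrite -row_free_unit -kermx_eq0; apply/rowV0P => v /sub_kermxP v0.
apply: (row_free_inj beta_free); rewrite mul0mx.
have: (v *m beta) *m (v *m beta)^T = 0 by rewrite trmx_mul !mulmxA -(mulmxA v) v0 mul0mx.
move=> /matrixP /(_ 0 0); rewrite mxE [RHS]mxE => /eqP.
under eq_bigr => k _ do rewrite [_^T _ _]mxE -expr2.
rewrite psumr_eq0 => [/allP H|k _]; last exact: sqr_ge0.
apply/rowP => k; rewrite [RHS]mxE; apply/eqP; rewrite -sqrf_eq0.
by apply: H; apply: mem_index_enum.
Qed.

(** The invertible Gram matrix lets the terms be peeled off in turn: multiplying by [beta^T] on the
    right isolates [U^T + beta^T *m S], multiplying that by [beta] on the left isolates [S], and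
    [beta *m G = 0] then disposes of [V]. In the application [V] is the [U] of the starred word. *)
Lemma orthogonal_decomposition (G : 'M[R]_r) (U V : 'M[R]_(n, r)) (S : 'M[R]_n) :
  G = U^T *m beta + beta^T *m V + beta^T *m S *m beta ->
  U *m beta^T = 0 -> V *m beta^T = 0 -> G *m beta^T = 0 -> beta *m G = 0 ->
  [/\ U = 0, S = 0 & G = 0].
Proof.
move=> GE Ub Vb Gb bG; have gu := gram_unit.
have bU : beta *m U^T = 0 by rewrite -[beta]trmxK -trmx_mul Ub trmx0.
have E1 : U^T + beta^T *m S = 0.
  rewrite -[LHS](mulmxK gu) (_ : _ *m (beta *m beta^T) = 0) ?mul0mx //.
  rewrite mulmxA mulmxDl -[RHS]Gb GE !mulmxDl; congr (_ + _).
  by rewrite -(mulmxA beta^T V) Vb mulmx0 addr0.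
have S0 : S = 0.
  rewrite -[LHS](mulKmx gu) -mulmxA.
  have -> : beta *m (beta^T *m S) = beta *m (U^T + beta^T *m S).
    by rewrite mulmxDr bU add0r.
  by rewrite E1 !mulmx0.
have U0 : U = 0 by move: E1; rewrite S0 mulmx0 addr0 => /(canRL trmxK); rewrite trmx0.
have GV : G = beta^T *m V by rewrite GE U0 S0 trmx0 mulmx0 !mul0mx add0r addr0.
by split; rewrite // GV -[V](mulKmx gu) -mulmxA -GV bG !mulmx0.
Qed.

End GramMatrices.

(** * Normal forms modulo the [iota] *)

Section Descent.
Context (R : realType) (g l r mu : nat) (b : 'I_r -> monomial g l).
Context (iota : 'I_mu -> ncrow R g l).
Implicit Types (P : ncrow R g l) (s : seq (letter g)).

Definition beta : 'M[R]_(mu, r) := \matrix_(j, k) row_coeff (iota j) (b k).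

(** The case [d = 0] is the normal form; general [d] lets it be reached from the top degree
    downwards. *)
Definition orth_from d P := forall i s, (d <= size s)%N ->
  \sum_k row_coeff P ((b k).1, FMonom (s ++ (b k).2)) * beta i k = 0.

Hypothesis iota_bdeg : forall j, bdeg b 1 (iota j).
Hypothesis beta_free : row_free beta.

Lemma bdegW d d' P : (d <= d')%N -> bdeg b d P -> bdeg b d' P.
Proof. by move=> dd' dP k s ds; apply: dP; apply: leq_trans ds. Qed.

(** [mmeasure] is the degree plus one, and zero for the zero polynomial, so this bounds all word
    lengths strictly. *)
Definition row_deg P := \max_j mmeasure (@fdeg (letter g)) (P 0%R j).

Lemma bdeg_row_deg P : bdeg b (row_deg P) P.
Proof.
move=> k s ds; apply: mcoeff_outdom.
apply: (mmeasure_mnm_ge (mf := @fdeg (letter g))) => /=.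
rewrite fdegE size_cat; apply: leq_trans (leq_trans ds (leq_addr _ _)).
exact: leq_bigmax.
Qed.

(** There are only finitely many words of length [D], enumerated by tuples, so any values on them
    are the coefficients of a polynomial. *)
Lemma homogeneous_poly D (f : word g -> R) : exists a : ncpoly R g,
  forall u, a@_u = if fdeg u == D then f u else 0.
Proof.
exists (\sum_(t : D.-tuple (letter g)) << f (FMonom t) *g FMonom t >>) => u.
rewrite raddf_sum /=; under eq_bigr => t _ do rewrite mcoeffU.
case: eqP => [uD|uD].
  have uD' : size u == D by rewrite -fdegE uD.
  rewrite (bigD1 (Tuple uD')) //= fmK eqxx big1 ?addr0 // => t tu.
  by case: eqP => // E; case/eqP: tu; apply: val_inj; rewrite /= -E.
by rewrite big1 // => t _; case: eqP => // E; case: uD; rewrite -E fdegE size_tuple.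
Qed.

(** Degree by degree from the top, the component of each coefficient vector in the row space of
    [beta] is removed by a homogeneous multiple of the [iota]. This leaves higher degrees untouched
    and may disturb lower ones, which come later in the induction. *)
Lemma orth_decomposition P :
  exists a : 'I_mu -> ncpoly R g, orth_from 0 (P - \sum_j a j *: iota j).
Proof.
have: orth_from (row_deg P) P.
  by move=> i s ds; rewrite big1 // => k _; rewrite bdeg_row_deg ?mul0r.
move: (row_deg P) => D; elim: D P => [|D IH] P dP.
  by exists (fun=> 0); rewrite big1 ?subr0 // => j _; rewrite scale0r.
pose pv s : 'rV[R]_r := \row_k row_coeff P ((b k).1, FMonom (s ++ (b k).2)).
(* [A s] holds the coordinates, in the rows of [beta], of the orthogonal projection of [pv s] onto
   their span. *)
pose A s : 'rV_mu := pv s *m beta^T *m invmx (beta *m beta^T).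
have /choice[a aE] (j : 'I_mu) := homogeneous_poly D (fun u => A u 0 j).
have aD j (u : word g) : (D < fdeg u)%N -> (a j)@_u = 0.
  by move=> Du; rewrite aE gtn_eqF.
have [a' a'P] : exists a', orth_from 0
    (P - \sum_j a j *: iota j - \sum_j a' j *: iota j).
  apply: IH => i s Ds.
  under eq_bigr => k _ do rewrite row_coeffB row_coeff_sum
    (eq_bigr _ (fun j _ => row_coeffZ_top k (aD j) (iota_bdeg j) Ds)) mulrBl.
  rewrite sumrB; have [sD|sD] := eqVneq (size s) D; last first.
    rewrite dP ?ltn_neqAle 1?eq_sym ?sD // sub0r big1 ?oppr0 // => k _.
    rewrite big1 ?mul0r // => j _; rewrite aD ?mul0r //.
    by rewrite fdegE ltn_neqAle eq_sym sD.
  transitivity ((pv s *m beta^T - A s *m beta *m beta^T) 0 i).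
    rewrite !mxE; congr (_ - _); apply: eq_bigr => k _; rewrite [beta^T _ _]mxE.
      by rewrite [pv s _ _]mxE.
    congr (_ * _); rewrite mxE; apply: eq_bigr => j _.
    by rewrite aE fdegE sD eqxx [beta _ _]mxE.
  by rewrite -mulmxA mulmxKV ?gram_unit // subrr mxE.
exists (fun j => a j + a' j); move: a'P.
by under [in X in _ -> X]eq_bigr do rewrite scalerDl; rewrite big_split /= opprD addrA.
Qed.

(** * Comparing top degrees in the hermitian identity *)

Section Identity.
Context (sigma : nat) (ps : seq (ncrow R g l)) (n : 'I_mu -> ncrow R g l)
  (S : 'I_mu -> 'I_mu -> ncpoly R g) (alpha theta : 'I_sigma -> ncrow R g l).
Hypothesis ps_orth : forall p, p \in ps -> orth_from 0 p.
Hypothesis n_orth : forall j, orth_from 0 (n j).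
Hypothesis alpha_bdeg : forall k, bdeg b 1 (alpha k).
Hypothesis theta_bdeg : forall k, bdeg b 0 (theta k).
Hypothesis ps_sum : \sum_(p <- ps) mxstar p *m p =
  \sum_j (mxstar (n j) *m iota j + mxstar (iota j) *m n j)
  + \sum_i mxstar (iota i) *m (\sum_j S i j *: iota j)
  + \sum_k (mxstar (alpha k) *m theta k + mxstar (theta k) *m alpha k).

(* [uphalf D]: the square of a part of degree [d] lives in degree [2 d]. *)
Definition bounded D :=
  [/\ forall p, p \in ps -> bdeg b (uphalf D) p,
      forall j, bdeg b D (n j)
    & forall i j (u : word g), (D <= fdeg u)%N -> (S i j)@_u = 0].

Lemma bounded_some : exists D, bounded D.
Proof.
pose D1 := (\max_(p <- ps) row_deg p)%N; pose D2 := (\max_j row_deg (n j))%N.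
pose D3 := (\max_i \max_j mmeasure (@fdeg (letter g)) (S i j))%N.
(* [D1] enters twice because [bounded] grants the [p] only half of its bound. *)
exists (D1 + D1 + D2 + D3)%N; split.
- move=> p pps; apply: (bdegW _ (@bdeg_row_deg p)).
  have le : (row_deg p <= D1)%N by apply: (leq_bigmax_seq _ pps).
  apply: leq_trans le _; rewrite addnn -addnA -[X in (X <= _)%N]uphalf_double.
  by apply: uphalf_leq; rewrite leq_addr.
- move=> j; apply: (bdegW _ (@bdeg_row_deg _)).
  have le : (row_deg (n j) <= D2)%N by apply: leq_bigmax.
  by apply: leq_trans le _; rewrite -addnA addnCA leq_addr.
- move=> i j u Du; apply: mcoeff_outdom.
  apply: (mmeasure_mnm_ge (mf := @fdeg (letter g))) => /=.
  apply: leq_trans (leq_trans (leq_addl _ D3) Du).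
  rewrite /D3 (bigD1 i) //= (bigD1 j) //= -maxnA; exact: leq_maxl.
Qed.

Section Step.
Context (D : nat).
Hypothesis D_bound : bounded D.+1.
Let h := D./2.

(** With the [p] of degree at most [h], their squares reach degree [D] only when [D] is even; the
    parity factor makes the matrix zero otherwise. *)
Definition gram s : 'M[R]_r := \matrix_(k1, k2) \sum_(p <- ps) (~~ odd D)%:R *
  (row_coeff p ((b k1).1, FMonom (seq_star (take h s) ++ (b k1).2)) *
   row_coeff p ((b k2).1, FMonom (drop h s ++ (b k2).2))).

Definition ncoef s : 'M[R]_(mu, r) :=
  \matrix_(j, k) row_coeff (n j) ((b k).1, FMonom (s ++ (b k).2)).

Definition scoef s : 'M[R]_mu := \matrix_(i, j) (S i j)@_(FMonom s).

Lemma betaE j k : row_coeff (iota j) ((b k).1, FMonom ([::] ++ (b k).2)) = beta j k.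
Proof. by rewrite mxE fmK -surjective_pairing. Qed.

(** This is [ps_sum] read at the words [b_k1^* s b_k2]: for [s] of length [D] only products of
    top-degree parts remain. *)
Lemma gramE s : size s = D ->
  gram s = (ncoef (seq_star s))^T *m beta + beta^T *m ncoef s
           + beta^T *m scoef s *m beta.
Proof.
move=> sD; case: D_bound => p_bdeg n_bdeg S_bound.
apply/matrixP => k1 k2.
have := congr1 (fun Q => midc b Q k1 k2 s) ps_sum => /=.
rewrite !midcD !midc_sum.
(* The [theta] terms have bounds [1] and [0], whose sum is at most [(size s).+1], so they vanish at
   every [s]. *)
rewrite [X in _ + X]big1 ?addr0 => [|k _]; last first.
  rewrite midcD; apply: etrans (addr0 0); congr (_ + _).
    exact: mid0 (alpha_bdeg k) (theta_bdeg k) _ _ _.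
  exact: mid0 (theta_bdeg k) (alpha_bdeg k) _ _ _.
have -> : \sum_(p <- ps) midc b (mxstar p *m p) k1 k2 s = gram s k1 k2.
  rewrite mxE big_seq [RHS]big_seq; apply: eq_bigr => p pps.
  (* For odd [D] the two bounds [h.+1] add up to [D.+1] and [mid0] applies; for even [D] the top
     parts meet exactly and [midE] applies. *)
  have dp := p_bdeg p pps; case: (boolP (odd D)) => oD.
    have DE : D = (h.*2).+1 by rewrite -[LHS]odd_double_half oD.
    have hD : (uphalf D.+1 <= D.+1)%N.
      by rewrite /= ltnS -[X in (_ <= X)%N]odd_double_half -addnn addnA leq_addl.
    by rewrite mul0r (mid0 k1 k2 dp dp) ?sD //= addSn addnS addnn -DE.
  have DE : D = h.*2 by rewrite -[LHS]odd_double_half (negbTE oD).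
  by rewrite mul1r (midE k1 k2 dp dp) // sD {1}DE addnn.
move=> ->; rewrite [RHS]mxE; congr (_ + _).
  under eq_bigr do rewrite midcD.
  rewrite big_split /= [RHS]mxE; congr (_ + _); rewrite mxE; apply: eq_bigr => j _.
    rewrite (@midE _ _ _ _ b D 0 _ _ k1 k2 s (n_bdeg j) (iota_bdeg j)) ?addn0 //.
    by rewrite -sD take_size drop_size betaE [_^T _ _]mxE [ncoef _ _ _]mxE.
  rewrite (@midE _ _ _ _ b 0 D _ _ k1 k2 s (iota_bdeg j) (n_bdeg j)) //.
  by rewrite take0 drop0 betaE [beta^T _ _]mxE [ncoef _ _ _]mxE.
rewrite -mulmxA mxE.
apply: eq_bigr => i _; rewrite mxE.
have top k t : (D <= size t)%N ->
    row_coeff (\sum_j S i j *: iota j) ((b k).1, FMonom (t ++ (b k).2)) =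
    \sum_j (S i j)@_(FMonom t) * beta j k.
  move=> Dt; rewrite row_coeff_sum; apply: eq_bigr => j _.
  have aD (u : word g) : (D < fdeg u)%N -> (S i j)@_u = 0 by exact: S_bound.
  by rewrite (row_coeffZ_top k aD (iota_bdeg j) Dt) mxE.
have Sb : bdeg b D.+1 (\sum_j S i j *: iota j).
  move=> k t Dt; rewrite top ?(ltnW Dt) // big1 // => j _.
  by rewrite S_bound ?mul0r.
rewrite (@midE _ _ _ _ b 0 D _ _ k1 k2 s (iota_bdeg i) Sb) //.
rewrite take0 drop0 betaE top ?sD // !mxE; congr (_ * _).
by apply: eq_bigr => j _; rewrite !mxE.
Qed.

Lemma orth_row (P : ncrow R g l) t : orth_from 0 P ->
  (\row_k row_coeff P ((b k).1, FMonom (t ++ (b k).2))) *m beta^T = 0.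
Proof.
move=> oP; apply/rowP => i; rewrite mxE [RHS]mxE -[RHS](oP i t) //.
by apply: eq_bigr => k _; rewrite !mxE.
Qed.

Lemma ncoef_orth s : ncoef s *m beta^T = 0.
Proof.
apply/row_matrixP => j; rewrite row_mul row0 -(orth_row s (n_orth j)).
by congr (_ *m _); apply/rowP => k; rewrite !mxE.
Qed.

(** [gram s] is a combination of outer products of coefficient vectors of the [p], all orthogonal to
    the rows of [beta] by the normal form. *)
Lemma gram_orth s : gram s *m beta^T = 0 /\ beta *m gram s = 0.
Proof.
pose x (p : ncrow R g l) t := \row_k row_coeff p ((b k).1, FMonom (t ++ (b k).2)).
have -> : gram s = \sum_(p <- ps) (~~ odd D)%:R *:
    ((x p (seq_star (take h s)))^T *m x p (drop h s)).
  apply/matrixP => k1 k2; rewrite mxE summxE; apply: eq_bigr => p _.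
  by rewrite !mxE big_ord1 !mxE.
rewrite mulmx_suml mulmx_sumr; split; rewrite big_seq big1 // => p pps.
  by rewrite -scalemxAl -mulmxA (orth_row _ (ps_orth pps)) mulmx0 scaler0.
rewrite -scalemxAr mulmxA -[beta]trmxK -trmx_mul (orth_row _ (ps_orth pps)).
by rewrite trmx0 mul0mx scaler0.
Qed.

Lemma bounded_step : bounded D.
Proof.
have [p_bdeg n_bdeg S_bound] := D_bound.
have H s : size s = D -> [/\ ncoef (seq_star s) = 0, scoef s = 0 & gram s = 0].
  move=> sD; have [gb bg] := gram_orth s.
  refine (orthogonal_decomposition beta_free (gramE sD) (ncoef_orth _)
    (ncoef_orth _) gb bg).
split=> [p pps k s | j k s | i j u].
- rewrite leq_eqVlt => /predU1P[sD|]; last first.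
    move=> lt; apply: (p_bdeg p pps); apply: leq_trans lt; rewrite ltnS.
    by rewrite uphalf_half leq_addl.
  (* For odd [D] the numbers [uphalf D] and [uphalf D.+1] agree, so the old bound already
     suffices. *)
  have [oD|eD] := boolP (odd D).
    by apply: (p_bdeg p pps); rewrite -sD [uphalf D]uphalf_half oD.
  have sh : size s = h by rewrite -sD uphalf_half (negbTE eD).
  have DE : D = (h + h)%N by rewrite addnn -[LHS]odd_double_half (negbTE eD).
  (* At the self-adjoint word [s^* s] a diagonal entry of the Gram matrix is a sum of squares of the
     coefficients at [s b_k], so each of them is zero. *)
  have [] := H (seq_star s ++ s); first by rewrite size_cat size_seq_star sh DE.
  move=> _ _ /matrixP /(_ k k); rewrite !mxE take_size_cat ?size_seq_star //.
  rewrite drop_size_cat ?size_seq_star // seq_starK eD => /eqP.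
  under eq_bigr => q _ do rewrite mul1r -expr2.
  rewrite psumr_eq0 => [/allP /(_ p pps)|q _]; last exact: sqr_ge0.
  by rewrite /= sqrf_eq0 => /eqP.
- rewrite leq_eqVlt => /predU1P[sD|]; last exact: n_bdeg.
  have [] := H (seq_star s); first by rewrite size_seq_star.
  by rewrite seq_starK => /matrixP /(_ j k) + _ _; rewrite !mxE.
- rewrite leq_eqVlt => /predU1P[sD|]; last exact: S_bound.
  have [] := H u; first by rewrite sD fdegE.
  by move=> _ /matrixP /(_ i j) + _; rewrite !mxE fmK.
Qed.

End Step.

(** Some bound exists and each step lowers it by one; the bound [0] is the claim. *)
Lemma hermitian_identity :
  [/\ forall p, p \in ps -> bdeg b 0 p, forall j, bdeg b 0 (n j)
    & forall i j, S i j = 0].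
Proof.
have [D] := bounded_some; elim: D => [|D IH]; last by move/bounded_step.
case=> p0 n0 S0; split=> // i j; apply/malgP => u; rewrite mcoeff0; exact: S0.
Qed.

End Identity.

End Descent.

(** * Chip spaces *)

Section Subspaces.
Context (R : realType) (g : nat).

Section Closure.
Context (m n : nat) (V : set (ncmx R g m n)).
Hypothesis V_sub : linear_subspace V.

Lemma subspaceZ (c : R) u : V u -> V ((c%:MP : ncpoly R g) *: u).
Proof. by case: V_sub => V0 VD Vu; rewrite -[_ *: _]addr0; apply: VD. Qed.

Lemma subspaceD u v : V u -> V v -> V (u + v).
Proof.
by case: V_sub => _ VD Vu Vv; rewrite -[u]scale1r -mpolyC1E; apply: VD.
Qed.

Lemma subspaceB u v : V u -> V v -> V (u - v).
Proof.
move=> Vu Vv; apply: subspaceD => //.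
have -> : - v = ((- 1)%:MP : ncpoly R g) *: v.
  by rewrite raddfN /= mpolyC1E scaleN1r.
exact: subspaceZ.
Qed.

Lemma subspace_sum (T : eqType) (s : seq T) (F : T -> ncmx R g m n) :
  (forall i, i \in s -> V (F i)) -> V (\sum_(i <- s) F i).
Proof.
move=> VF; rewrite big_seq; apply: (big_ind V) => //; last exact: subspaceD.
by case: V_sub.
Qed.

End Closure.

Lemma linspan_subspace m n (S : set (ncmx R g m n)) : linear_subspace (linspan S).
Proof.
split=> [A [[]] //|c u v Su Sv A /[dup] HA [[_ AD] _]].
by apply: AD; [apply: Su|apply: Sv].
Qed.

Lemma sub_linspan m n (S : set (ncmx R g m n)) : S `<=` linspan S.
Proof. exact: sub_gen_smallest. Qed.

Lemma linspan_sub m n (S V : set (ncmx R g m n)) :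
  linear_subspace V -> S `<=` V -> linspan S `<=` V.
Proof. exact: smallest_sub. Qed.

Lemma malgC_comm (c : R) (p : ncpoly R g) : p * c%:MP = c%:MP * p.
Proof.
rewrite !malgM_def fgmulgU fgmulUg; apply: eq_bigr => w _.
by rewrite mulm1 mul1m mulrC.
Qed.

Lemma mxstarC m n (c : R) (A : ncmx R g m n) :
  mxstar ((c%:MP : ncpoly R g) *: A) = (c%:MP : ncpoly R g) *: mxstar A.
Proof.
by apply/matrixP => i j; rewrite !mxE ncpoly_starM ncpoly_starC malgC_comm.
Qed.

Lemma mul_span_star m n p (A : set (ncmx R g m n)) (B : set (ncmx R g n p)) Q :
  mul_span A B Q ->
  mul_span (@mxstar R g n p @` B) (@mxstar R g m n @` A) (mxstar Q).
Proof.
have [sp0 spD] : linear_subspace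
    (mul_span (@mxstar R g n p @` B) (@mxstar R g m n @` A)).
  exact: linspan_subspace.
move: Q; apply: linspan_sub; first split=> [|c u v].
- by rewrite mxstar0.
- by rewrite mxstarD mxstarC => Hu Hv; apply: spD.
move=> _ [a Aa [b Bb <-]]; rewrite mxstarM; apply: sub_linspan.
by exists (mxstar b); [exists b|exists (mxstar a); [exists a|]].
Qed.

Lemma const_star m n : @mxstar R g m n @` @const_ncmx R g m n = @const_ncmx R g n m.
Proof.
have star_map p q (A : 'M[R]_(p, q)) :
    mxstar (map_mx (@malgC (word g) R) A) = map_mx (@malgC (word g) R) A^T.
  by apply/matrixP => i j; rewrite !mxE ncpoly_starC.
apply/seteqP; split=> [_ [_ [A _ <-] <-]|_ [A _ <-]].
  by exists A^T.
exists (map_mx (@malgC (word g) R) A^T); first by exists A^T.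
by rewrite star_map trmxK.
Qed.

(** The span allows only constant columns on the left. Splitting [F] into coordinates moves its
    polynomial entries onto [h], where the module absorbs them. *)
Lemma mul_span_const_mul l (I : set (ncrow R g l)) (F : ncmx R g l 1) h :
  left_module I -> I h -> mul_span (@const_ncmx R g l 1) I (F *m h).
Proof.
move=> [I0 ID] Ih.
have -> : F *m h = \sum_i delta_mx i 0 *m (F i 0 *: h).
  apply/matrixP => i j; rewrite [LHS]mxE big_ord1 summxE.
  have T k : (delta_mx k 0 *m (F k 0 *: h)) i j = (i == k)%:R * (F k 0 * h 0 j).
    by rewrite mxE big_ord1 [delta_mx _ _ _ _]mxE eqxx andbT [(_ *: h) _ _]mxE.
  rewrite (eq_bigr _ (fun k _ => T k)) (bigD1 i) //= eqxx mul1r big1 ?addr0 //.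
  by move=> k ki; rewrite eq_sym (negbTE ki) mul0r.
apply: (subspace_sum (linspan_subspace _)) => i _; apply: sub_linspan.
exists (delta_mx i 0); first by exists (delta_mx i 0) => //; rewrite map_delta_mx.
by exists (F i 0 *: h) => //; rewrite -[_ *: h]addr0; apply: ID.
Qed.

Lemma scale_span_mul l (A : set (ncpoly R g)) (B : set (ncrow R g l)) a P :
  A a -> B P -> scale_span A B (a *: P).
Proof. by move=> Aa BP; apply: sub_linspan; exists a => //; exists P. Qed.

End Subspaces.

Section ChipSpaces.
Context (R : realType) (g l : nat) (C : set (ncrow R g l)).
Hypotheses (C_chip : right_chip_space C) (C_fin : finite_dimensional C).
Implicit Types (P : ncrow R g l) (m : monomial g l) (s : seq (letter g)).

Let E := @monomial_poly R g l.

Lemma support_subspace (M : set (monomial g l)) :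
  linear_subspace [set P : ncrow R g l | forall m, row_coeff P m != 0 -> M m].
Proof.
split=> [m|c u v Mu Mv m]; first by rewrite row_coeff0 eqxx.
rewrite row_coeffD row_coeffC.
have [u0|u0 _] := eqVneq (row_coeff u m) 0; last exact: Mu.
by rewrite u0 mulr0 add0r; apply: Mv.
Qed.

Lemma chip_subspace : linear_subspace C.
Proof. by case: C_chip => -[M ->] _; apply: linspan_subspace. Qed.

Lemma chip_memE P : C P <-> forall m, row_coeff P m != 0 -> C (E m).
Proof.
split=> [CP m|H].
  case: C_chip => -[M CM] _ Pm; rewrite CM; apply: sub_linspan.
  suff : M m by exists m.
  move: P CP m Pm; rewrite CM; apply: linspan_sub; first exact: support_subspace.
  move=> _ [m Mm <-] m'; rewrite row_coeff_monomial.
  by have [<-|_] := eqVneq m m'; rewrite ?eqxx.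
have [s sP ->] := row_monomialE P.
apply: (subspace_sum chip_subspace) => m ms; apply: (subspaceZ chip_subspace).
by apply: H; rewrite -sP.
Qed.

Lemma chip_suffix j s t : C (E (j, FMonom (s ++ t))) -> C (E (j, FMonom t)).
Proof.
case: C_chip => _ chip Cst; apply: chip Cst _.
by exists (FMonom s); rewrite /wmul mmulE.
Qed.

(** All elements of [C] are supported in the union of the supports of a finite spanning family. *)
Lemma chip_finite : exists ms : seq (monomial g l), forall m, C (E m) -> m \in ms.
Proof.
case: C_fin => ps CE.
have [ms msP] : exists ms : seq (monomial g l),
    forall P m, P \in ps -> row_coeff P m != 0 -> m \in ms.
  elim: ps {CE} => [|Q ps [ms IH]]; first by exists [::].
  have [s sQ _] := row_monomialE Q; exists (s ++ ms) => P m.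
  rewrite inE mem_cat => /predU1P[->|Pps Pm]; first by rewrite sQ => ->.
  by rewrite (IH P) ?orbT.
exists ms => m; rewrite CE => Em.
have H : [set` ps] `<=` [set P : ncrow R g l | forall m, row_coeff P m != 0 -> m \in ms].
  by move=> P /= Pps m'; apply: msP.
apply: (linspan_sub (support_subspace _) H Em).
by rewrite row_coeff_monomial eqxx oner_eq0.
Qed.

(** A nonzero coefficient of [a *: c] comes from a cut whose prefix has at most one letter and whose
    suffix is a monomial of [C]. *)
Lemma deg_le1_span_support P : scale_span (@deg_le1 R g) C P ->
  forall m, row_coeff P m != 0 ->
  C (E m) \/ exists (a : letter g) s, m.2 = FMonom (a :: s) /\ C (E (m.1, FMonom s)).
Proof.
move: P; apply: linspan_sub; first exact: support_subspace.
move=> _ [a a1 [c Cc <-]] [j u] /=; rewrite row_coeffZ => sum_neq0.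
have [i ai] : exists i : 'I_(size u).+1,
    a@_(FMonom (take i u)) * row_coeff c (j, FMonom (drop i u)) != 0.
  apply/existsP; apply: contraNT sum_neq0; rewrite negb_exists => /forallP H.
  by rewrite big1 // => i _; apply/eqP; rewrite -[_ == _]negbK.
move: ai; rewrite mulf_eq0 negb_or => /andP[ai ci].
have {}ci := (chip_memE c).1 Cc _ ci.
have := a1 (FMonom (take i u)); rewrite -mcoeff_neq0 => /(_ ai).
rewrite fdegE /= size_takel; last by rewrite -ltnS.
case: u i {ai sum_neq0} ci => -[|x u] [[|[|i]] lti] //= ci _.
- by left.
- by left.
by right; exists x, u; rewrite drop0 in ci.
Qed.

(** Candidates are the [e_j] and the products of one letter with a finite list containing the
    monomials of [C]; those outside [C] are kept. Stripping letters from a monomial outside [C]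
    until just before it enters [C], or becomes empty, ends at one of them. *)
Lemma outer_monomials : exists r (b : 'I_r -> monomial g l),
  [/\ forall k, ~ C (E (b k)),
      forall m, ~ C (E m) -> exists k s, m = ((b k).1, FMonom (s ++ (b k).2))
    & forall j a s, ~ C (E (j, FMonom (a :: s))) -> C (E (j, FMonom s)) ->
        exists k, (j, FMonom (a :: s)) = b k].
Proof.
have [ms msP] := chip_finite.
pose cands : seq (monomial g l) := [seq (j, FMonom [::]) | j <- enum 'I_l] ++
  [seq (m.1, FMonom (a :: (m.2 : seq _))) | a <- enum (letter g : finType), m <- ms].
pose bs := [seq m <- cands | ~~ `[< C (E m) >]].
have bsP m : m \in cands -> ~ C (E m) -> exists k, m = tnth (in_tuple bs) k.
  move=> mc nm; apply/tnthP; rewrite mem_filter mc andbT; exact/asboolPn.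
have next j a s : ~ C (E (j, FMonom (a :: s))) -> C (E (j, FMonom s)) ->
    exists k, (j, FMonom (a :: s)) = tnth (in_tuple bs) k.
  move=> nas Cs; apply: bsP nas; rewrite mem_cat; apply/orP; right.
  apply/allpairsP; exists (a, (j, FMonom s)).
  by rewrite mem_enum /=; split=> //; apply: msP.
exists (size bs), (tnth (in_tuple bs)); split=> //.
  move=> k; have := mem_tnth k (in_tuple bs).
  by rewrite mem_filter => /andP[/asboolPn].
case=> j [s]; elim: s => [|a s IH] ns.
  have [|k bk] := bsP (j, FMonom [::]) _ ns.
    by rewrite mem_cat map_f ?mem_enum.
  by exists k, [::]; rewrite -bk.
have [Cs|nCs] := pselect (C (E (j, FMonom s))).
  by have [k bk] := next j a s ns Cs; exists k, [::]; rewrite -bk.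
have [k [t [jE sE]]] := IH nCs; exists k, (a :: t).
by rewrite -jE sE.
Qed.

Section Outer.
Context (r : nat) (b : 'I_r -> monomial g l).
Hypotheses (b_out : forall k, ~ C (E (b k)))
  (b_cover : forall m, ~ C (E m) -> exists k s, m = ((b k).1, FMonom (s ++ (b k).2))).

(** A monomial ending in some [b k] cannot lie in [C], since its right chip [b k] does not; by
    [b_cover] these are all the monomials outside [C]. *)
Lemma chip_bdegE P : C P <-> bdeg b 0 P.
Proof.
split=> [CP k s _|dP].
  apply/eqP; apply/negPn/negP => /((chip_memE P).1 CP) /chip_suffix.
  by rewrite fmK -surjective_pairing; apply: b_out.
apply/chip_memE => m; apply: contraNP => nm; apply/eqP.
by have [k [s ->]] := b_cover nm; apply: dP.
Qed.

(** If [s] is nonempty, removing the first letter of [s b_k] still leaves a word ending in [b_k],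
    hence outside [C]. *)
Lemma deg_le1_span_bdeg P : scale_span (@deg_le1 R g) C P -> bdeg b 1 P.
Proof.
move=> CP k s s1; apply/eqP; apply/negPn/negP.
move=> /(deg_le1_span_support CP)[/chip_suffix|[a [t /= [E1 Ct]]]].
  by rewrite fmK -surjective_pairing; apply: b_out.
case: s s1 E1 => [//|x s] _ [_ tE]; move: Ct; rewrite -tE => /chip_suffix.
by rewrite fmK -surjective_pairing; apply: b_out.
Qed.

End Outer.
End ChipSpaces.

Lemma scale_combD (A : nzRingType) (V : lmodType A) n m (x : A)
    (a a' : 'I_n -> A) (e e' : 'I_m -> A) (u : 'I_n -> V) (v : 'I_m -> V) :
  x *: (\sum_i a i *: u i + \sum_k e k *: v k)
    + (\sum_i a' i *: u i + \sum_k e' k *: v k) =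
  \sum_i (x * a i + a' i) *: u i + \sum_k (x * e k + e' k) *: v k.
Proof.
rewrite scalerDr addrACA !scaler_sumr -!big_split /=.
by congr (_ + _); apply: eq_bigr => i _; rewrite scalerDl scalerA.
Qed.

(** * Leading monomials and C-bases *)

Section Leading.
Context (R : realType) (g l : nat) (lt : rel (monomial g l)).
Hypothesis lt_total : strict_total_order lt.
Implicit Types (P Q : ncrow R g l) (m : monomial g l).

Lemma lt_asym m m' : lt m m' -> lt m' m -> False.
Proof. by case: lt_total => irr tr _ /tr /[apply]; rewrite irr. Qed.

Lemma exists_maximum (s : seq (monomial g l)) : s != [::] ->
  exists2 m, m \in s & forall m', m' \in s -> m' != m -> lt m' m.
Proof.
case: lt_total => irr tr tot.
elim: s => [//|x s IH] _; have [->|s0] := eqVneq s [::].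
  by exists x; rewrite ?inE // => m'; rewrite inE => /eqP ->; rewrite eqxx.
have [m ms mP] := IH s0; have [xm|mx] := boolP (lt m x).
  exists x; first by rewrite inE eqxx.
  move=> m'; rewrite inE => /predU1P[->|m's _]; first by rewrite eqxx.
  by have [->//|/(mP _ m's) m'm] := eqVneq m' m; apply: tr xm.
exists m; first by rewrite inE ms orbT.
move=> m'; rewrite inE => /predU1P[->|m's]; last exact: mP.
by move/tot; rewrite (negbTE mx) orbF.
Qed.

Lemma leading_exists P : P != 0 -> exists m, leading lt P m.
Proof.
have [s sP PE] := row_monomialE P => P0.
have [|m ms mP] := @exists_maximum s.
  by apply: contraNneq P0 => s0; rewrite PE s0 big_nil.
by exists m; split; [rewrite -sP|move=> m'; rewrite -sP; apply: mP].
Qed.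

Lemma leading_uniq P m m' : leading lt P m -> leading lt P m' -> m = m'.
Proof.
move=> [Pm mP] [Pm' m'P]; apply/eqP; apply/negPn/negP => mm'.
by apply: (@lt_asym m m'); [apply: m'P|apply: mP; rewrite // eq_sym].
Qed.

Lemma leadingC (c : R) P m : c != 0 ->
  leading lt P m -> leading lt ((c%:MP : ncpoly R g) *: P) m.
Proof.
move=> c0 [Pm mP]; split=> [|m']; rewrite row_coeffC mulf_eq0 negb_or c0 //.
exact: mP.
Qed.

Lemma monic_leading P m : Defs.monic lt P -> leading lt P m -> row_coeff P m = 1.
Proof. by case=> m' /leading_uniq P1 Pm' /P1 <-. Qed.

(** Otherwise [P], scaled to be monic, could be added to [S] against maximality. *)
Lemma maximal_leading X S P m :
  maximal_distinct_monic lt X S ->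
  (forall (c : R) Q, c != 0 -> X Q -> X ((c%:MP : ncpoly R g) *: Q)) ->
  X P -> leading lt P m -> exists2 Q, S Q & leading lt Q m.
Proof.
move=> [[SX Smon Sdist] Smax] Xscale XP Pm.
have [//|nQ] := pselect (exists2 Q, S Q & leading lt Q m).
have c0 := Pm.1; set c := row_coeff P m in c0.
pose P1 := ((c^-1)%:MP : ncpoly R g) *: P.
have P1m : leading lt P1 m by apply: leadingC; rewrite ?invr_eq0.
have S' : distinct_monic lt X (S `|` [set P1]).
  split=> [Q [/SX //|->]|Q [/Smon //|->]|Q Q' m' [SQ|->] [SQ'|->] Qm Q'm].
  - by apply: Xscale; rewrite ?invr_eq0.
  - by exists m; rewrite // row_coeffC mulVf.
  - exact: Sdist Q'm.
  - by case: nQ; exists Q; rewrite // (leading_uniq P1m Q'm).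
  - by case: nQ; exists Q'; rewrite // (leading_uniq P1m Qm).
  - by [].
exists P1 => //; rewrite -(Smax _ S'); first by right.
by move=> Q; left.
Qed.

End Leading.

(** * Reduction modulo a [C]-basis *)

Section Basis.
Context (R : realType) (g l : nat) (C I : set (ncrow R g l))
  (lt0 : rel (word g)) (ltC : rel (monomial g l)) (mu sigma : nat)
  (iota : 'I_mu -> ncrow R g l) (theta : 'I_sigma -> ncrow R g l).
Hypotheses (C_chip : right_chip_space C) (C_fin : finite_dimensional C)
  (I_module : left_module I) (ltC_ord : C_order C lt0 ltC)
  (iota_inj : injective iota)
  (basis : C_basis ltC C I (range iota) (range theta)).
Implicit Types (P : ncrow R g l) (m : monomial g l).

Let E := @monomial_poly R g l.
Let RC := scale_span (@deg_le1 R g) C.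

Let lt_total : strict_total_order ltC := ltC_ord.1.

Lemma iota_props j : [/\ I (iota j), RC (iota j), ~ C (iota j) & Defs.monic ltC (iota j)].
Proof.
case: basis => -[[sub mon _] _] _.
have [Ij [Rj nCj]] := sub (iota j) (ex_intro2 _ _ j Logic.I erefl).
by split=> //; apply: mon; exists j.
Qed.

Lemma theta_props k : [/\ I (theta k), C (theta k) & Defs.monic ltC (theta k)].
Proof.
case: basis => _ [[sub mon _] _].
have [Ik Ck] := sub (theta k) (ex_intro2 _ _ k Logic.I erefl).
by split=> //; apply: mon; exists k.
Qed.

Lemma module_subspace : linear_subspace I.
Proof. by case: I_module => I0 ID; split=> // c u v; apply: ID. Qed.

Lemma deg_le1_1 : @deg_le1 R g 1.
Proof.
move=> w; rewrite -mcoeff_neq0 mcoeff1.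
by have [->|] := eqVneq w mone; rewrite ?fdeg1 ?eqxx.
Qed.

Lemma chip_sub_RC : C `<=` RC.
Proof.
move=> P CP; rewrite -[P]scale1r.
by apply: scale_span_mul => //; apply: deg_le1_1.
Qed.

(** Rule (1) puts every monomial outside [C] above those in [C], so a leading monomial in [C] would
    force the whole support into [C]. *)
Lemma leading_border P m : ~ C P -> leading ltC P m -> ~ C (E m).
Proof.
move=> nCP [Pm mP] Cm; apply: nCP; apply/(chip_memE C_chip) => m' Pm'.
have [//|nC] := pselect (C (E m')).
have [m'm|m'm] := eqVneq m' m; first by rewrite m'm.
have [_ [lt1 _ _ _]] := ltC_ord.
by case: (lt_asym lt_total (mP _ Pm' m'm) (lt1 _ _ Cm nC)).
Qed.

Definition const_comb (c : 'I_mu -> R) (d : 'I_sigma -> R) : ncrow R g l :=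
  \sum_j ((c j)%:MP : ncpoly R g) *: iota j + \sum_k ((d k)%:MP : ncpoly R g) *: theta k.

(** One division step: by maximality a [theta], if [P] lies in [C], or else an [iota] shares the
    leading monomial of [P], and subtracting a multiple cancels it. *)
Lemma basis_reduction P : I P -> RC P -> P != 0 ->
  exists m c d, leading ltC P m /\
  forall m', row_coeff (P - const_comb c d) m' != 0 -> ltC m' m.
Proof.
move=> IP RP P0; have [m Pm] := leading_exists lt_total P0.
have reduce Q : leading ltC Q m -> Defs.monic ltC Q -> forall m',
    row_coeff (P - ((row_coeff P m)%:MP : ncpoly R g) *: Q) m' != 0 -> ltC m' m.
  move=> Qm Qmon m'; rewrite row_coeffB row_coeffC.
  have [->|m'm] := eqVneq m' m.
    by rewrite (monic_leading lt_total Qmon Qm) mulr1 subrr eqxx.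
  have [P'0|P'0 _] := eqVneq (row_coeff P m') 0; last exact: Pm.2.
  by rewrite P'0 sub0r oppr_eq0 mulf_eq0 negb_or => /andP[_ Q'0]; apply: Qm.2.
have scaleI (c : R) Q : I Q -> I ((c%:MP : ncpoly R g) *: Q).
  exact: (subspaceZ module_subspace).
have [CP|nCP] := pselect (C P).
  have [_ max] := basis.
  have [||Q [k _ <-] Qm] := maximal_leading lt_total max _ _ Pm.
  - move=> c Q _ [IQ CQ]; split; first exact: scaleI.
    exact: (subspaceZ (chip_subspace C_chip)).
  - by [].
  have [_ _ mon] := theta_props k.
  exists m, (fun=> 0), (fun k' => if k' == k then row_coeff P m else 0); split=> //.
  rewrite /const_comb big1 ?add0r => [|j _]; last by rewrite raddf0 scale0r.
  rewrite (bigD1 k) //= eqxx big1 ?addr0; first exact: reduce.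
  by move=> k' /negbTE ->; rewrite raddf0 scale0r.
have [max _] := basis.
have [||Q [j _ <-] Qm] := maximal_leading lt_total max _ _ Pm.
- move=> c Q c0 [IQ [RQ nCQ]]; split; first exact: scaleI.
  split; first exact: (subspaceZ (linspan_subspace _)).
  move=> /(subspaceZ (chip_subspace C_chip) c^-1).
  by rewrite scalerA -mpolyCM mulVf // mpolyC1E scale1r.
- by [].
have [_ _ _ mon] := iota_props j.
exists m, (fun j' => if j' == j then row_coeff P m else 0), (fun=> 0); split=> //.
rewrite /const_comb [X in _ - (_ + X)]big1 ?addr0 => [|k _]; last first.
  by rewrite raddf0 scale0r.
rewrite (bigD1 j) //= eqxx big1 ?addr0; first exact: reduce.
by move=> j' /negbTE ->; rewrite raddf0 scale0r.
Qed.

Lemma const_combD c d c' d' : const_comb c d + const_comb c' d' =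
  const_comb (fun j => c j + c' j) (fun k => d k + d' k).
Proof.
rewrite /const_comb addrACA.
congr (_ + _); rewrite -big_split /=.
  by apply: eq_bigr => i _; rewrite monalgUD scalerDl.
by apply: eq_bigr => i _; rewrite monalgUD scalerDl.
Qed.

Lemma const_comb_mem c d : I (const_comb c d) /\ RC (const_comb c d).
Proof.
have subI := module_subspace.
have subR : linear_subspace RC by apply: linspan_subspace.
split; [apply: (subspaceD subI)|apply: (subspaceD subR)];
  [apply: (subspace_sum subI) => i _; apply: (subspaceZ subI); by case: (iota_props i)
  |apply: (subspace_sum subI) => i _; apply: (subspaceZ subI); by case: (theta_props i)
  |apply: (subspace_sum subR) => i _; apply: (subspaceZ subR); by case: (iota_props i)|].
apply: (subspace_sum subR) => i _; apply: (subspaceZ subR).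
by apply: chip_sub_RC; case: (theta_props i).
Qed.

Lemma RC_finite : exists ts : seq (monomial g l),
  forall P m, RC P -> row_coeff P m != 0 -> m \in ts.
Proof.
have [ms msP] := chip_finite C_fin.
exists (ms ++ [seq (m.1, FMonom (a :: (m.2 : seq _)))
              | a <- enum (letter g : finType), m <- ms]).
move=> P [j u] RP /(deg_le1_span_support C_chip RP)[/msP|[a [s /= [-> Cs]]]].
  by rewrite mem_cat => ->.
rewrite mem_cat; apply/orP; right; apply/allpairsP; exists (a, (j, FMonom s)).
by rewrite mem_enum /=; split=> //; apply: msP.
Qed.

(** Repeated division terminates because only finitely many monomials occur in [RC]; the induction
    is on the rank of the monomials among them. *)
Lemma const_comb_span P : I P -> RC P -> exists c d, P = const_comb c d.
Proof.
have [ts tsP] := RC_finite; pose rank m := count (fun m' => ltC m' m) ts.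
have [irr tr _] := lt_total.
have : forall n P, I P -> RC P -> (forall m, row_coeff P m != 0 -> (rank m < n)%N) ->
    exists c d, P = const_comb c d.
  elim=> [|n IH] {}P IP RP Prank.
    exists (fun=> 0), (fun=> 0); rewrite /const_comb !big1 ?addr0 => [|i _|i _];
      rewrite ?raddf0 ?scale0r //.
    apply: row_coeffP => m; rewrite row_coeff0; apply/eqP.
    by apply/negPn/negP => /Prank.
  have [P0|P0] := eqVneq P 0.
    exists (fun=> 0), (fun=> 0); rewrite /const_comb !big1 ?addr0 => [//|i _|i _];
      by rewrite ?raddf0 ?scale0r.
  have [m [c [d [Pm cdP]]]] := basis_reduction IP RP P0.
  have [IQ RQ] := const_comb_mem c d.
  have RB : RC (P - const_comb c d) by apply: (subspaceB (linspan_subspace _)).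
  have [|m' m'B|c' [d' E']] := IH (P - const_comb c d) _ RB.
  - exact: (subspaceB module_subspace).
  - have m'm := cdP _ m'B; have m't := tsP _ _ RB m'B.
    rewrite -ltnS; apply: leq_trans (Prank m Pm.1).
    (* The rank drops strictly: all that lies below [m'] lies below [m], and [m'] itself is counted
       for [m] but not for [m']. *)
    have one : (0 < count (pred1 m') ts)%N by rewrite -has_count has_pred1.
    have disj : count (predI (fun x => ltC x m') (pred1 m')) ts = 0%N.
      by apply/eqP; rewrite -leqn0 leqNgt -has_count; apply/hasPn => x _ /=;
        apply/andP => -[+ /eqP xm]; rewrite xm irr.
    rewrite ltnS -addn1; apply: leq_trans (leq_add (leqnn _) one) _.
    rewrite -count_predUI disj addn0; apply: sub_count => x /= /orP[xm'|/eqP -> //].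
    exact: tr m'm.
  exists (fun j => c' j + c j), (fun k => d' k + d k).
  by rewrite -const_combD -E' subrK.
move=> /(_ (size ts).+1 P) H IP RP; apply: H => // m _.
by rewrite ltnS count_size.
Qed.

Section Outer.
Context (r : nat) (b : 'I_r -> monomial g l).
Hypotheses (b_out : forall k, ~ C (E (b k)))
  (b_cover : forall m, ~ C (E m) -> exists k s, m = ((b k).1, FMonom (s ++ (b k).2)))
  (b_next : forall j a s, ~ C (E (j, FMonom (a :: s))) -> C (E (j, FMonom s)) ->
        exists k, (j, FMonom (a :: s)) = b k).

(** A leading monomial of [iota j] lies outside [C] but is one letter times a monomial of [C], hence
    some [b k]. Injectivity is claimed for [b \o k] since [b] may have repetitions. *)
Lemma iota_leading : exists k : 'I_mu -> 'I_r, injective (b \o k) /\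
  forall j, leading ltC (iota j) (b (k j)) /\ row_coeff (iota j) (b (k j)) = 1.
Proof.
have /choice[k kP] j :
    exists k, leading ltC (iota j) (b k) /\ row_coeff (iota j) (b k) = 1.
  have [_ Rj nCj [m mlead m1]] := iota_props j.
  have nCm := leading_border nCj mlead.
  have [/nCm //|[a [s [mE Cs]]]] := deg_le1_span_support C_chip Rj mlead.1.
  have {}mE : m = (m.1, FMonom (a :: s)) by rewrite -mE -surjective_pairing.
  rewrite mE in nCm; have [k kE] := b_next nCm Cs.
  by exists k; rewrite -kE -mE; split.
exists k; split=> // i j /= kij; apply: iota_inj.
case: basis => -[[_ _ dist] _] _.
apply: (dist _ _ (b (k i))); [by exists i|by exists j|by case: (kP i)|].
by rewrite kij; case: (kP j).
Qed.

(** Echelon form: among the rows used in a vanishing combination, only the one with the largest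
    leading monomial has a nonzero entry in that column. *)
Lemma beta_free : row_free (beta b iota).
Proof.
have [k [k_inj kP]] := iota_leading; have [irr tr _] := lt_total.
rewrite -kermx_eq0; apply/rowV0P => v /sub_kermxP vb0; apply/eqP/negPn/negP => v0.
have [m ms mmax] : exists2 m, m \in [seq b (k j) | j <- enum 'I_mu & v 0 j != 0] &
    forall m', m' \in [seq b (k j) | j <- enum 'I_mu & v 0 j != 0] -> m' != m -> ltC m' m.
  apply: (exists_maximum lt_total); apply: contraNneq v0 => H; apply/eqP/rowP => j.
  rewrite mxE; apply/eqP/negPn/negP => vj.
  have : b (k j) \in [seq b (k j) | j <- enum 'I_mu & v 0 j != 0].
    by apply: map_f; rewrite mem_filter vj mem_enum.
  by rewrite H.
case/mapP: ms => j; rewrite mem_filter => /andP[vj _] mE.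
case/eqP: (vj); move/matrixP/(_ 0 (k j)): vb0; rewrite mxE [RHS]mxE.
rewrite (bigD1 j) //= [beta _ _ _ _]mxE (kP j).2 mulr1 big1 ?addr0 // => i ij.
rewrite mxE; have [->|vi] := eqVneq (v 0 i) 0; first by rewrite mul0r.
have neq : b (k i) != m by rewrite mE; apply: contraNneq ij => /k_inj ->.
have lti : ltC (b (k i)) m.
  by apply: mmax => //; apply: map_f; rewrite mem_filter vi mem_enum.
have [->|ci] := eqVneq (row_coeff (iota i) (b (k j))) 0; first by rewrite mulr0.
have [[_ imax] _] := kP i.
case: (lt_asym lt_total lti); rewrite mE; apply: imax => //.
by rewrite -mE eq_sym.
Qed.

End Outer.

Definition basis_comb (a : 'I_mu -> ncpoly R g) (d : 'I_sigma -> R) : ncrow R g l :=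
  \sum_j a j *: iota j + \sum_k ((d k)%:MP : ncpoly R g) *: theta k.

Definition combs : set (ncrow R g l) := [set P | exists a d, P = basis_comb a d].

Lemma const_comb_combs P : I P -> RC P -> combs P.
Proof.
move=> IP RP; have [c [d ->]] := const_comb_span IP RP.
by exists (fun j => (c j)%:MP), d.
Qed.

Lemma combs_subspace : linear_subspace combs.
Proof.
split=> [|c _ _ [a [d ->]] [a' [d' ->]]].
  exists (fun=> 0), (fun=> 0); rewrite /basis_comb !big1 ?addr0 => [//|i _|i _];
      by rewrite ?monalgU0 scale0r.
exists (fun j => c%:MP * a j + a' j), (fun k => c * d k + d' k).
have dE k : (c * d k + d' k)%:MP = c%:MP * (d k)%:MP + (d' k)%:MP :> ncpoly R g.
  by rewrite monalgUD mpolyCM.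
rewrite /basis_comb.
apply: etrans (scale_combD (c%:MP : ncpoly R g) a a'
  (fun k => (d k)%:MP) (fun k => (d' k)%:MP) iota theta) _.
apply: (congr2 +%R erefl); apply: eq_bigr => k _.
by rewrite dE.
Qed.

(** Real coefficients on the [theta] suffice because a letter times a combination of the [theta]
    falls back into [I] and [RC], where [const_comb_span] rewrites it. *)
Lemma combs_letter (a : letter g) P :
  combs P -> combs ((<< FMonom [:: a] >> : ncpoly R g) *: P).
Proof.
case=> c [d ->]; rewrite /basis_comb scalerDr scaler_sumr.
apply: (subspaceD combs_subspace).
  exists (fun j => << FMonom [:: a] >> * c j), (fun=> 0).
  rewrite /basis_comb [X in _ + X]big1 ?addr0 => [|k _]; last by rewrite monalgU0 scale0r.
  by apply: eq_bigr => j _; rewrite scalerA.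
have [I0 ID] := I_module; apply: const_comb_combs.
  rewrite -[_ *: _]addr0; apply: ID => //; apply: (subspace_sum module_subspace) => k _.
  by apply: (subspaceZ module_subspace); case: (theta_props k).
apply: scale_span_mul.
  by move=> w; rewrite msuppU1 inE => /eqP ->; rewrite fdegE.
apply: (subspace_sum (chip_subspace C_chip)) => k _.
by apply: (subspaceZ (chip_subspace C_chip)); case: (theta_props k).
Qed.

Lemma combs_module : left_module combs.
Proof.
have subc := combs_subspace.
split=> [|a P Q cP cQ]; first by case: subc.
apply: (subspaceD subc) => //; rewrite (monalgE a) scaler_suml.
apply: (subspace_sum subc) => -[s] _.
have -> : << a@_(FMonom s) *g FMonom s >> =
    (a@_(FMonom s))%:MP * << FMonom s >> :> ncpoly R g.
  by rewrite malgM_def fgmulUU mulr1 mul1m.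
rewrite -scalerA; apply: (subspaceZ subc).
elim: s => [|x s IH].
  have -> : << FMonom [::] >> = 1 :> ncpoly R g by rewrite -fmoneE.
  by rewrite scale1r.
have -> : << FMonom (x :: s) >> = << FMonom [:: x] >> * << FMonom s >> :> ncpoly R g.
  by rewrite malgM_def fgmulUU mulr1 mmulE.
by rewrite -scalerA; apply: combs_letter.
Qed.

Lemma module_combs (S : set (ncrow R g l)) :
  S `<=` RC -> I = left_module_gen S -> I `<=` combs.
Proof.
move=> SR IE P; rewrite {1}IE; apply: smallest_sub; first exact: combs_module.
move=> Q SQ; apply: const_comb_combs; last exact: SR.
by rewrite IE; apply: sub_gen_smallest.
Qed.

End Basis.

Lemma left_module_gen_module (R : realType) (g l : nat) (S : set (ncrow R g l)) :
  left_module (left_module_gen S).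
Proof.
split=> [A [[]] //|a u v Su Sv A /[dup] HA [[_ AD] _]].
by apply: AD; [apply: Su|apply: Sv].
Qed.

(** * Reduction to the hermitian identity *)

Section AbstractMatrices.
Context (A : nzRingType) (l n m : nat).

Lemma mulmx_comb (e : 'cV[A]_l) (a : 'I_n -> A) (d : 'I_m -> A)
    (u : 'I_n -> 'rV[A]_l) (v : 'I_m -> 'rV[A]_l) :
  e *m (\sum_j a j *: u j + \sum_k d k *: v k) =
  \sum_j (e *m (a j)%:M) *m u j + \sum_k (e *m (d k)%:M) *m v k.
Proof.
rewrite mulmxDr !mulmx_sumr.
by congr (_ + _); apply: eq_bigr => j _; rewrite -mul_scalar_mx mulmxA.
Qed.

Lemma mulmx_sumDlr (x w : 'cV[A]_l) (y v : 'rV[A]_l)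
    (b : 'I_n -> 'cV[A]_l) (c : 'I_m -> 'rV[A]_l) :
  (x + \sum_i b i) *m v + w *m (y + \sum_i c i) =
  x *m v + w *m y + (\sum_i b i *m v + \sum_i w *m c i).
Proof. by rewrite mulmxDl mulmxDr mulmx_suml mulmx_sumr addrACA. Qed.

Lemma mulmx_sum_scaleDl (w : 'cV[A]_l) (a a' : 'I_n -> A) (u : 'I_n -> 'rV[A]_l) :
  w *m (\sum_j (a j + a' j) *: u j) =
  \sum_j w *m (a j *: u j) + \sum_j w *m (a' j *: u j).
Proof.
rewrite mulmx_sumr -big_split; apply: eq_bigr => j _.
by rewrite scalerDl mulmxDr.
Qed.

Lemma mulmx_subr_square (x y : 'cV[A]_l) (p h : 'rV[A]_l) :
  (x - y) *m (p - h) - x *m p = - (x *m h + y *m (p - h)).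
Proof.
rewrite mulmxBl [x *m (p - h)]mulmxBr opprD -!addrA addrC -!addrA.
by rewrite addNr addr0.
Qed.

End AbstractMatrices.

Lemma sum_pairs (V : zmodType) n (x z : 'I_n -> V) (p q : 'I_n -> 'I_n -> V) :
  (forall i, z i = \sum_j p j i + \sum_j q i j) ->
  \sum_j (x j + (\sum_i p j i + \sum_i q j i)) = \sum_j x j + \sum_i z i.
Proof.
move=> zE; rewrite big_split; congr (_ + _).
by rewrite (eq_bigr _ (fun i _ => zE i)) !big_split exchange_big.
Qed.

Lemma addrCACA (V : zmodType) (u v u' v' : V) : u + v' + (u' + v) = u + v + (u' + v').
Proof. by rewrite [u' + v]addrC addrACA [v' + u']addrC. Qed.

Section Columns.
Context (R : realType) (g l mu sigma : nat) (I : set (ncrow R g l))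
  (iota : 'I_mu -> ncrow R g l) (theta : 'I_sigma -> ncrow R g l).

Let colI := mul_span (@const_ncmx R g l 1) I.
Let cst m n : 'M[R]_(m, n) -> ncmx R g m n := map_mx (@malgC (word g) R).

(** Elements of [I] have real coefficients on the [theta], so constant columns in front keep the
    multipliers of the [theta] constant. *)
Lemma columns U : I `<=` combs iota theta -> colI U ->
  exists (F : 'I_mu -> ncmx R g l 1) (A : 'I_sigma -> 'M[R]_(l, 1)),
  U = \sum_j F j *m iota j + \sum_k cst (A k) *m theta k.
Proof.
move=> I_combs; move: U; apply: linspan_sub; first split.
- exists (fun=> 0), (fun=> 0); rewrite !big1 ?addr0 // => i _; last by rewrite mul0mx.
  by rewrite /cst map_mx0 mul0mx.
- move=> c _ _ [F [A ->]] [F' [A' ->]].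
  exists (fun j => (c%:MP : ncpoly R g) *: F j + F' j), (fun k => c *: A k + A' k).
  rewrite scalerDr addrACA.
  apply: (congr2 +%R).
    rewrite scaler_sumr -big_split /=; apply: eq_bigr => j _.
    by rewrite mulmxDl scalemxAl.
  rewrite scaler_sumr -big_split /=; apply: eq_bigr => k _.
  by rewrite /cst map_mxD map_mxZ mulmxDl scalemxAl.
move=> _ [_ [e _ <-] [_ /I_combs[a [d ->]] <-]].
exists (fun j => cst e *m (a j)%:M), (fun k => e *m (d k)%:M).
apply: etrans (mulmx_comb _ _ _ _ _) _; apply: (congr2 +%R erefl).
by apply: eq_bigr => k _; rewrite /cst map_mxM map_scalar_mx.
Qed.

(** Averaging [X = u + v] with its star gives half of [u + v^*] as [H]; the star of [v] lies in the
    same span as [u]. *)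
Lemma hermitian_split X : mxstar X = X ->
  [set u + v | u in colI
             & v in mul_span (@mxstar R g 1 l @` I) (@const_ncmx R g 1 l)] X ->
  exists2 H, colI H & X = H + mxstar H.
Proof.
move=> Xstar [u uI [v vI uvX]].
have vI' : colI (mxstar v).
  have := mul_span_star vI; rewrite const_star; congr (mul_span _ _ _).
  apply/seteqP; split=> [_ [_ [h Ih <-] <-]|h Ih]; first by rewrite mxstarK.
  by exists (mxstar h); [exists h|rewrite mxstarK].
have subI : linear_subspace colI by apply: linspan_subspace.
exists ((2^-1)%:MP *: (u + mxstar v)).
  by apply: (subspaceZ subI); apply: (subspaceD subI).
rewrite mxstarC -scalerDr mxstarD mxstarK.
have -> : u + mxstar v + (mxstar u + v) = X + X.
  apply: etrans (addrCACA u v (mxstar u) (mxstar v)) _.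
  by rewrite -mxstarD uvX Xstar.
rewrite -[X + X]mulr2n -scaler_nat scalerA.
have -> : (2^-1)%:MP * 2%:R = 1 :> ncpoly R g.
  by rewrite -mpolyC_nat -mpolyCM mulVf ?mpolyC1E // pnatr_eq0.
by rewrite scale1r.
Qed.

Lemma mxstarZ_mul (a : ncpoly R g) (P Q : ncrow R g l) :
  mxstar (a *: P) *m Q = mxstar P *m (ncpoly_star a *: Q).
Proof. by rewrite mxstarZ -mulmxA mul_scalar_mx. Qed.

(** The [iota] parts of the multipliers move across the star, and exchanging the indices in one of
    the two double sums collects them between [iota_i^*] and [iota_j]. *)
Lemma symmetrize (n : 'I_mu -> ncrow R g l) (a : 'I_mu -> 'I_mu -> ncpoly R g) :
  let f j := n j + \sum_i a j i *: iota i in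
  \sum_j (mxstar (f j) *m iota j + mxstar (iota j) *m f j) =
  \sum_j (mxstar (n j) *m iota j + mxstar (iota j) *m n j)
  + \sum_i mxstar (iota i) *m (\sum_j (ncpoly_star (a j i) + a i j) *: iota j).
Proof.
move=> f.
have fE j : mxstar (f j) *m iota j + mxstar (iota j) *m f j =
    mxstar (n j) *m iota j + mxstar (iota j) *m n j
    + (\sum_i mxstar (iota i) *m (ncpoly_star (a j i) *: iota j)
       + \sum_i mxstar (iota j) *m (a j i *: iota i)).
  rewrite /f mxstarD mxstar_sum.
  apply: etrans (mulmx_sumDlr _ _ _ _ _ _) _; apply: (congr2 +%R erefl).
  by apply: (congr2 +%R _ erefl); apply: eq_bigr => i _; apply: mxstarZ_mul.
apply: etrans (eq_bigr _ (fun j _ => fE j)) _.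
by apply: sum_pairs => i; apply: mulmx_sum_scaleDl.
Qed.

End Columns.

(** * Compression by a self-adjoint matrix and coordinate projections *)

Section Compression.
Context (R : realType) (g l : nat) (Pi : ncmx R g l l).
Hypothesis Pi_star : mxstar Pi = Pi.

Definition compress (M : ncmx R g l l) : ncmx R g l l := Pi *m M *m Pi.

Lemma compressD M N : compress (M + N) = compress M + compress N.
Proof. by rewrite /compress mulmxDr mulmxDl. Qed.

Lemma compress_sum (T : Type) (s : seq T) (F : T -> ncmx R g l l) :
  compress (\sum_(i <- s) F i) = \sum_(i <- s) compress (F i).
Proof. by rewrite /compress mulmx_sumr mulmx_suml. Qed.

Lemma compress_star (P Q : ncrow R g l) :
  compress (mxstar P *m Q) = mxstar (P *m Pi) *m (Q *m Pi).
Proof. by rewrite mxstarM Pi_star /compress !mulmxA. Qed.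

Lemma compress_sym (P Q P' Q' : ncrow R g l) : P *m Pi = P' -> Q *m Pi = Q' ->
  compress (mxstar P *m Q + mxstar Q *m P) = mxstar P' *m Q' + mxstar Q' *m P'.
Proof.
move=> <- <-; apply: etrans (compressD _ _) _.
by apply: congr2; apply: compress_star.
Qed.

(** Multiplication by [Pi] on both sides fixes every product of rows fixed by [Pi], so only the
    [alpha] change. *)
Lemma compress_identity n m (ps : seq (ncrow R g l)) (q u : 'I_n -> ncrow R g l)
    (alpha v : 'I_m -> ncrow R g l) :
  (forall p, p \in ps -> p *m Pi = p) -> (forall j, q j *m Pi = q j) ->
  (forall j, u j *m Pi = u j) -> (forall k, v k *m Pi = v k) ->
  \sum_(p <- ps) mxstar p *m p =
    \sum_j (mxstar (q j) *m u j + mxstar (u j) *m q j)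
    + \sum_k (mxstar (alpha k) *m v k + mxstar (v k) *m alpha k) ->
  \sum_(p <- ps) mxstar p *m p =
    \sum_j (mxstar (q j) *m u j + mxstar (u j) *m q j)
    + \sum_k (mxstar (alpha k *m Pi) *m v k + mxstar (v k) *m (alpha k *m Pi)).
Proof.
move=> psPi qPi uPi vPi /(congr1 compress) H.
have L : compress (\sum_(p <- ps) mxstar p *m p) = \sum_(p <- ps) mxstar p *m p.
  apply: etrans (compress_sum _ _) _; apply: eq_big_seq => p /psPi pPi.
  by apply: etrans (compress_star _ _) _; rewrite pPi.
apply: etrans (esym L) (etrans H _).
apply: etrans (compressD _ _) _; apply: congr2; apply: etrans (compress_sum _ _) _;
  by apply: eq_bigr => i _; apply: compress_sym.
Qed.

End Compression.

Section Projection.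
Context (R : realType) (g l : nat) (D : pred 'I_l).

Definition coord_proj : 'M[R]_l := diag_mx (\row_j (D j)%:R).
Definition nc_proj : ncmx R g l l := map_mx (@malgC (word g) R) coord_proj.

Lemma nc_proj_star : mxstar nc_proj = nc_proj.
Proof.
apply/matrixP => i j; rewrite !mxE ncpoly_starC eq_sym.
by have [->|_] := eqVneq i j; rewrite ?mulr0n.
Qed.

Lemma row_coeff_proj (P : ncrow R g l) m :
  row_coeff (P *m nc_proj) m = row_coeff P m * (D m.1)%:R.
Proof.
case: m => j w; rewrite /row_coeff /=.
have -> : (P *m nc_proj) 0 j = (D j)%:R%:MP * P 0 j.
  rewrite mxE (bigD1 j) //= big1 => [|k kj].
    by rewrite addr0 !mxE eqxx mulr1n malgC_comm.
  by rewrite !mxE (negbTE kj) mulr0n monalgU0 mulr0.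
by rewrite mcoeffCM mulrC.
Qed.

Lemma nc_proj_id (P : ncrow R g l) : (forall m, row_coeff P m != 0 -> D m.1) ->
  P *m nc_proj = P.
Proof.
move=> PD; apply: row_coeffP => m; rewrite row_coeff_proj.
have [->|/PD ->] := eqVneq (row_coeff P m) 0; by rewrite ?mul0r ?mulr1.
Qed.

End Projection.

(** * Sums of squares modulo the module *)

Section SquareSums.
Context (R : realType) (g l : nat) (I : set (ncrow R g l)).
Hypothesis I_module : left_module I.

Definition real_span : set (ncmx R g l l) :=
  [set u + v | u in mul_span (@const_ncmx R g l 1) I
             & v in mul_span (@mxstar R g 1 l @` I) (@const_ncmx R g 1 l)].

Lemma real_span_subspace : linear_subspace real_span.
Proof.
have [c0 cD] : linear_subspace (mul_span (@const_ncmx R g l 1) I).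
  exact: linspan_subspace.
have [r0 rD] : linear_subspace
    (mul_span (@mxstar R g 1 l @` I) (@const_ncmx R g 1 l)).
  exact: linspan_subspace.
split=> [|c _ _ [u Iu [v Iv <-]] [u' Iu' [v' Iv' <-]]].
  by exists 0 => //; exists 0 => //; rewrite addr0.
exists ((c%:MP : ncpoly R g) *: u + u'); first exact: cD.
exists ((c%:MP : ncpoly R g) *: v + v'); first exact: rD.
by rewrite scalerDr; apply: (addrACA (_ *: u)).
Qed.

Lemma real_span_l (P Q : ncrow R g l) : I Q -> real_span (mxstar P *m Q).
Proof.
move=> IQ; exists (mxstar P *m Q); first exact: mul_span_const_mul.
exists 0; last exact: addr0.
by have [] : linear_subspace
    (mul_span (@mxstar R g 1 l @` I) (@const_ncmx R g 1 l)) by exact: linspan_subspace.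
Qed.

Lemma real_span_star M : real_span M -> real_span (mxstar M).
Proof.
move=> [u Iu [v Iv <-]]; rewrite mxstarD.
have II : @mxstar R g l 1 @` (@mxstar R g 1 l @` I) = I.
  apply/seteqP; split=> [_ [_ [h Ih <-] <-]|h Ih]; first by rewrite mxstarK.
  by exists (mxstar h); [exists h|rewrite mxstarK].
exists (mxstar v); first by have := mul_span_star Iv; rewrite const_star II.
exists (mxstar u); first by have := mul_span_star Iu; rewrite const_star.
exact: addrC.
Qed.

Lemma real_span_r (P Q : ncrow R g l) : I Q -> real_span (mxstar Q *m P).
Proof.
by move=> /(real_span_l P) /real_span_star; rewrite mxstarM mxstarK.
Qed.

(** Every term of the difference contains [h] or its star; hence squares may be replaced by those of
    normal forms. *)
Lemma real_span_square (p h : ncrow R g l) : I h ->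
  real_span (mxstar (p - h) *m (p - h) - mxstar p *m p).
Proof.
move=> Ih.
have -> : mxstar (p - h) *m (p - h) - mxstar p *m p =
    - (mxstar p *m h + mxstar h *m (p - h)).
  have -> : mxstar (p - h) = mxstar p - mxstar h.
    by apply/eqP; rewrite eq_sym subr_eq -mxstarD subrK.
  exact: mulmx_subr_square.
rewrite -sub0r; have subR := real_span_subspace.
apply: (subspaceB subR); first by case: subR.
by apply: (subspaceD subR); [apply: real_span_l|apply: real_span_r].
Qed.

End SquareSums.

Lemma const_row_coeff (R : realType) (g l : nat) (P : ncrow R g l) m :
  const_ncmx P -> row_coeff P m != 0 -> m.2 = FMonom [::].
Proof.
move=> [e _ <-]; rewrite /row_coeff mxE mcoeffC.
by case: (m.2 =P mone) => [-> _|_]; [apply: fmoneE|rewrite eqxx].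
Qed.

Lemma const_bdeg (R : realType) (g l r : nat) (b : 'I_r -> monomial g l)
    (P : ncrow R g l) : const_ncmx P -> bdeg b 1 P.
Proof.
move=> cP k s s1; apply/eqP/negPn/negP => /(const_row_coeff cP) /= [E].
by case: s s1 E.
Qed.

Theorem theorem7p3 (R : realType) (g l : nat)
    (C I : set (ncrow R g l))
    (lt0 : rel (word g)) (ltC : rel (monomial g l))
    (mu sigma : nat)
    (iota : 'I_mu -> ncrow R g l) (theta : 'I_sigma -> ncrow R g l)
    (C_chip : right_chip_space C) (C_fin : finite_dimensional C)
    (I_gen : exists2 S : set (ncrow R g l),
       S `<=` scale_span (@deg_le1 R g) C & I = left_module_gen S)
    (lt0_deg : degree_order lt0) (ltC_ord : C_order C lt0 ltC)
    (iota_inj : injective iota) (theta_inj : injective theta)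
    (basis : C_basis ltC C I (range iota) (range theta)) :
  real_module I <->
  (forall (ps : seq (ncrow R g l)) (q : 'I_mu -> ncrow R g l)
      (alpha : 'I_sigma -> ncrow R g l),
    (forall p, p \in ps -> C p) ->
    (forall j, C (q j)) ->
    (forall k, (@const_ncmx R g 1 l `&` C) (alpha k)) ->
    \sum_(p <- ps) mxstar p *m p =
      \sum_(j < mu) (mxstar (q j) *m iota j + mxstar (iota j) *m q j) +
      \sum_(k < sigma) (mxstar (alpha k) *m theta k
                        + mxstar (theta k) *m alpha k) ->
    forall p, p \in ps -> I p).
Proof.
case: I_gen => S SR IE.
have I_mod : left_module I by rewrite IE; apply: left_module_gen_module.
have subC := chip_subspace C_chip.
have [_ ID] := I_mod.
have iotaP := iota_props basis; have thetaP := theta_props basis.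
split=> [I_real ps q alpha _ _ _ E p pps|cond ps real_ps].
  (* Each term on the right of the identity has a factor [iota] or [theta], or its star, from
     [I]. *)
  apply: (I_real ps) pps; rewrite -/(real_span I _) E.
  have subR := real_span_subspace I.
  apply: (subspaceD subR); apply: (subspace_sum subR) => i _; apply: (subspaceD subR).
  - by apply: real_span_l => //; case: (iotaP i).
  - by apply: real_span_r => //; case: (iotaP i).
  - by apply: real_span_l => //; case: (thetaP i).
  - by apply: real_span_r => //; case: (thetaP i).
have [r [b [b_out b_cover b_next]]] := outer_monomials C_fin.
have CE P : C P <-> bdeg b 0 P := chip_bdegE C_chip b_out b_cover P.
have iota_bdeg j : bdeg b 1 (iota j).
  by apply: (deg_le1_span_bdeg C_chip b_out); case: (iotaP j).
have theta_bdeg k : bdeg b 0 (theta k) by apply/CE; case: (thetaP k).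
have b_free := beta_free C_chip ltC_ord iota_inj basis b_next.
have Icombs : I `<=` combs iota theta.
  exact: (module_combs C_chip C_fin I_mod ltC_ord basis SR IE).
(* Each row [P] splits into [h P], a combination of the [iota] and so in [I], and its normal form
   [nf P]. *)
have /choice[a aP] := orth_decomposition iota_bdeg b_free.
pose h P := \sum_j a P j *: iota j.
have Ih P : I (h P).
  apply: (subspace_sum (module_subspace I_mod)) => j _.
  by rewrite -[_ *: _]addr0; apply: ID; [case: (iotaP j)|case: I_mod].
pose nf P := P - h P.
suff nfI : forall p, p \in ps -> I (nf p).
  move=> p pps; rewrite -[p](subrK (h p)).
  by apply: (subspaceD (module_subspace I_mod)); [apply: nfI|apply: Ih].
pose ps' := map nf ps.
have ps'E : \sum_(p <- ps') mxstar p *m p = \sum_(p <- ps) mxstar (nf p) *m nf p.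
  exact: big_map.
have [H IH HE] : exists2 H, mul_span (@const_ncmx R g l 1) I H &
    \sum_(p <- ps') mxstar p *m p = H + mxstar H.
  apply: hermitian_split.
    apply: etrans (mxstar_sum _ _) _; apply: eq_bigr => p _.
    by rewrite mxstarM mxstarK.
  rewrite -/(real_span I _) ps'E.
  have subR := real_span_subspace I.
  have -> : \sum_(p <- ps) mxstar (nf p) *m nf p = \sum_(p <- ps) mxstar p *m p
      + \sum_(p <- ps) (mxstar (nf p) *m nf p - mxstar p *m p).
    rewrite -big_split; apply: eq_bigr => p _.
    exact: etrans (esym (subrK _ _)) (addrC _ _).
  apply: (subspaceD subR real_ps); apply: (subspace_sum subR) => p _.
  by apply: real_span_square.
(* The stars of the columns [F j] are the multipliers of the [iota], those of the real columns [A k]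
   the constants [alpha k]. *)
have [F [A FA]] := columns Icombs IH.
pose f j := mxstar (F j).
pose alpha k : ncrow R g l := mxstar (map_mx (@malgC (word g) R) (A k)).
pose n j := nf (f j).
have HfE : H = \sum_j mxstar (f j) *m iota j + \sum_k mxstar (alpha k) *m theta k.
  rewrite FA; apply: congr2; apply: eq_bigr => i _; congr (_ *m _);
    exact/esym/mxstarK.
have HsE : mxstar H =
    \sum_j mxstar (iota j) *m f j + \sum_k mxstar (theta k) *m alpha k.
  rewrite HfE mxstarD; apply: congr2; apply: etrans (mxstar_sum _ _) _;
    by apply: eq_bigr => i _; rewrite mxstarM mxstarK.
have id1 : \sum_(p <- ps') mxstar p *m p =
    \sum_j (mxstar (f j) *m iota j + mxstar (iota j) *m f j)
    + \sum_k (mxstar (alpha k) *m theta k + mxstar (theta k) *m alpha k).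
  rewrite HE HsE HfE; apply: etrans (addrACA _ _ _ _) _.
  by apply: congr2; apply: esym; apply: big_split.
have alpha_const k : @const_ncmx R g 1 l (alpha k).
  rewrite -const_star; exists (map_mx (@malgC (word g) R) (A k)); last exact: erefl.
  by exists (A k).
(* Replacing [f j] by its normal form [n j] leaves combinations of the [iota], which [s] gathers
   into a middle term. *)
pose s i j := ncpoly_star (a (f j) i) + a (f i) j.
have id2 : \sum_(p <- ps') mxstar p *m p =
    \sum_j (mxstar (n j) *m iota j + mxstar (iota j) *m n j)
    + \sum_i mxstar (iota i) *m (\sum_j s i j *: iota j)
    + \sum_k (mxstar (alpha k) *m theta k + mxstar (theta k) *m alpha k).
  apply: etrans id1 _; apply: (congr2 +%R _ erefl).
  apply: etrans (symmetrize iota n (fun j => a (f j))).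
  apply: eq_bigr => j _.
  have fE : f j = n j + \sum_i a (f j) i *: iota i by rewrite /n /nf subrK.
  by rewrite -fE.
have alpha_bdeg k : bdeg b 1 (alpha k) by apply: const_bdeg.
have [ps'_bdeg n_bdeg s0] : [/\ forall p, p \in ps' -> bdeg b 0 p,
    forall j, bdeg b 0 (n j) & forall i j, s i j = 0].
  apply: (hermitian_identity iota_bdeg b_free _ _ alpha_bdeg theta_bdeg id2).
    by move=> _ /mapP[p _ ->]; apply: aP.
  by move=> j; apply: aP.
have id3 : \sum_(p <- ps') mxstar p *m p =
    \sum_j (mxstar (n j) *m iota j + mxstar (iota j) *m n j)
    + \sum_k (mxstar (alpha k) *m theta k + mxstar (theta k) *m alpha k).
  apply: etrans id2 _; apply: (congr2 +%R _ erefl).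
  apply: etrans _ (addr0 _); apply: (congr2 +%R erefl).
  apply: big1 => i _; apply: etrans (mulmx0 _ _); congr (_ *m _).
  by apply: big1 => j _; rewrite s0 scale0r.
(* The constants [alpha k] need not lie in C; projecting the identity onto the
   coordinates [e_j] of C repairs this and fixes everything else. *)
pose D : pred 'I_l := fun j => `[< C (monomial_poly R (j, FMonom [::])) >].
have RD P : scale_span (@deg_le1 R g) C P -> P *m nc_proj R g D = P.
  move=> RP; apply: nc_proj_id => m /(deg_le1_span_support C_chip RP) Pm.
  apply/asboolP; case: Pm => [|[x [t [_]]]].
    (* Appending the empty word exhibits [e_j] as a right chip of the monomial. *)
    rewrite [m in C (_ m) -> _]surjective_pairing -[m.2]fmK -[fmonom_val m.2]cats0.
    exact: chip_suffix.
  rewrite -[t]cats0; exact: chip_suffix.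
have CD P : C P -> P *m nc_proj R g D = P.
  by move=> /chip_sub_RC; apply: RD.
have id4 := compress_identity (nc_proj_star R g D) _ _ _ _ id3.
move=> p pps; apply: (cond ps' n (fun k => alpha k *m nc_proj R g D)).
- by move=> p' /ps'_bdeg /CE.
- by move=> j; apply/CE.
- move=> k; split.
    have [e _ <-] := alpha_const k; exists (e *m coord_proj R D); first by [].
    exact: map_mxM.
  apply/(chip_memE C_chip) => -[j w]; rewrite row_coeff_proj mulf_eq0 negb_or.
  move=> /andP[/(const_row_coeff (alpha_const k)) /= ->].
  by rewrite pnatr_eq0 eqb0 negbK => /asboolP.
- apply: id4.
  + by move=> p' /ps'_bdeg /CE; apply: CD.
  + by move=> j; apply/CD/CE.
  + by move=> j; apply: RD; case: (iotaP j).
  + by move=> k; apply: CD; case: (thetaP k).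
exact: map_f.
Qed.
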